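(* Let $\mathfrak F\subset\mathcal E_{n,\lambda,\Lambda}$ be a nonempty compact family (in the topology of locally uniform convergence) such that $\mathcal S_{A,t}G\in\mathfrak F$ whenever $G\in\mathfrak F$, $A\in\mathcal S^n$, $G(A)=0$ and $t>0$. Let $$\mathcal Q:=\{\alpha\in(0,1]:\ \mathcal H_G(B)\subset C^{2,\alpha}_{\mathrm{loc}}(B)\text{ for every }G\in\mathfrak F\text{ and every ball }B\subset\mathbb R^n\},$$ and let $\mathcal E$ be the set of $\alpha\in(0,1]$ for which there is $C<\infty$ such that $$R\|Du\|_{L^\infty(B_{R/2}(x_0))}+R^2\|D^2u\|_{L^\infty(B_{R/2}(x_0))}+R^{2+\alpha}[D^2u]_{C^{0,\alpha}(B_{R/2}(x_0))}\le C\operatorname{osc}_{B_R(x_0)}u$$ for every ball $B_R(x_0)$, every $G\in\mathfrak F$ and every $u\in\mathcal H_G(B_R(x_0))$. If $\mathcal Q$ is nonempty, then $\sup\mathcal Q=\sup\mathcal E$.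
   Context: Fix $n\ge2$ and $0<\lambda\le\Lambda$. $\mathcal S^n$ is the space of real symmetric $n\times n$ matrices with the Frobenius norm; $N\ge0$ means positive semidefinite. $\mathcal E_{n,\lambda,\Lambda}$ is the set of $G\in C(\mathcal S^n)$ with $G(0)=0$ and $\lambda\operatorname{tr}N\le G(M+N)-G(M)\le\Lambda\operatorname{tr}N$ for all $M\in\mathcal S^n$, $N\ge0$; it carries the topology of locally uniform convergence on $\mathcal S^n$. For $A\in\mathcal S^n$, $t>0$, $(\mathcal S_{A,t}G)(M):=t[G(A+t^{-1}M)-G(A)]$. For an open set $\Omega$, $\mathcal H_G(\Omega)$ is the set of viscosity solutions of $G(D^2u)=0$ in $\Omega$: continuous $u$ such that, for $C^2$ test functions $\varphi$, $G(D^2\varphi(x))\ge0$ whenever $\varphi$ touches $u$ from above at $x\in\Omega$, and $G(D^2\varphi(x))\le0$ whenever $\varphi$ touches $u$ from below at $x\in\Omega$. $B_r(x_0)$ is the open ball. $\operatorname{osc}_Eu:=\sup_Eu-\inf_Eu$ (an inequality with right-hand side $+\infty$ is vacuous). For $0<\beta\le1$, $[g]_{C^{0,\beta}(E)}:=\sup_{x\ne y\in E}|g(x)-g(y)|/|x-y|^\beta$. The displayed estimate includes the assertion that $u$ is classically twice differentiable on $B_{R/2}(x_0)$ when the right-hand side is finite. *)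

(* Defs.v *)
(* MathComp-Analysis. Points of R^n are row vectors 'rV[R]_n; the library's
   norm and balls on matrices are those of the maximum norm, so the Euclidean
   and Frobenius norms and Euclidean balls are introduced here. The topology is
   the same. *)
From HB Require Import structures.
From mathcomp Require Import all_boot all_order all_algebra.
From mathcomp Require Import all_classical all_reals all_analysis.
From mathcomp Require Import ring.

Set Implicit Arguments.
Unset Strict Implicit.
Unset Printing Implicit Defensive.

Import Order.TTheory GRing.Theory Num.Theory.
Import numFieldNormedType.Exports.

Local Open Scope classical_set_scope.
Local Open Scope ring_scope.

Section SymmetricMatrices.
Variables (R : realType) (n : nat).

Definition symmetric_pred : {pred 'M[R]_n} := fun M => M^T == M.

Fact symmetric_submod_closed : subsemimod_closed symmetric_pred.
Proof.
split; first split.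
- by rewrite unfold_in raddf0.
- by move=> M N /eqP sM /eqP sN; rewrite unfold_in raddfD /= sM sN.
- by move=> a M /eqP sM; rewrite unfold_in linearZ /= sM.
Qed.

Fact symmetric_opp_closed : oppr_closed symmetric_pred.
Proof. by move=> M /eqP sM; rewrite unfold_in raddfN /= sM. Qed.

HB.instance Definition _ :=
  GRing.isSubSemiModClosed.Build R 'M[R]_n symmetric_pred
    symmetric_submod_closed.
HB.instance Definition _ :=
  GRing.isOppClosed.Build 'M[R]_n symmetric_pred symmetric_opp_closed.

Record symmx := Symmx {
  symmx_val :> 'M[R]_n;
  _ : symmx_val \in symmetric_pred }.

HB.instance Definition _ := [isSub for symmx_val].
HB.instance Definition _ := [Choice of symmx by <:].
HB.instance Definition _ := [SubChoice_isSubZmodule of symmx by <:].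
HB.instance Definition _ := [SubZmodule_isSubLmodule of symmx by <:].

HB.instance Definition _ :=
  PseudoMetric.copy symmx (initial_topology symmx_val).

Fact sym_part_subproof (M : 'M[R]_n) :
  2^-1 *: (M + M^T) \in symmetric_pred.
Proof. by rewrite unfold_in linearZ /= raddfD /= trmxK addrC. Qed.

Definition sym_part (M : 'M[R]_n) : symmx := Symmx (sym_part_subproof M).

Lemma sym_part_id (M : 'M[R]_n) : M^T = M -> sym_part M = M :> 'M[R]_n.
Proof.
by move=> sM /=; rewrite sM; apply/matrixP => i j; rewrite !mxE; field.
Qed.

End SymmetricMatrices.

Section Elliptic.
Variables (R : realType) (n : nat).
Implicit Types (G : symmx R n -> R) (A M N : symmx R n).

Definition psdmx (N : 'M[R]_n) := forall x : 'rV[R]_n, 0 <= (x *m N *m x^T) 0 0.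

Definition elliptic (lam Lam : R) : set (symmx R n -> R) :=
  [set G | [/\ continuous G, G 0 = 0 &
    forall M N, psdmx N ->
      lam * \tr (N : 'M[R]_n) <= G (M + N) - G M <= Lam * \tr (N : 'M[R]_n)]].

Definition rescale A (t : R) G : symmx R n -> R :=
  fun M => t * (G (A + t^-1 *: M) - G A).

End Elliptic.

Section Calculus.
Variables (R : realType) (n : nat).
Implicit Types (u : 'rV[R]_n -> R) (W E : set 'rV[R]_n) (x : 'rV[R]_n).

Definition fnorm (p q : nat) (M : 'M[R]_(p, q)) : R :=
  Num.sqrt (\sum_i \sum_j M i j ^+ 2).

Definition eball x (r : R) : set 'rV[R]_n := [set y | fnorm (y - x) < r].

Definition grad u x : 'rV[R]_n := \row_i 'D_(delta_mx 0 i) (u : _ -> R^o) x.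

Definition hess u x : 'M[R]_n := 'J (grad u) x.

(* The next two notions are only used on open sets. *)
Definition twice_differentiable W u :=
  forall x, W x -> differentiable (u : _ -> R^o) x /\ differentiable (grad u) x.

Definition C2 W u :=
  twice_differentiable W u /\ forall x, W x -> {for x, continuous (hess u)}.

Local Open Scope ereal_scope.

Definition osc E u : \bar R :=
  ereal_sup [set (u x)%:E | x in E] - ereal_inf [set (u x)%:E | x in E].

(* Supremum instead of essential supremum; the two agree for continuous
   functions on open sets. *)
Definition sup_norm (p q : nat) E (g : 'rV[R]_n -> 'M[R]_(p, q)) : \bar R :=
  ereal_sup [set (fnorm (g x))%:E | x in E].

Definition holder_seminorm (p q : nat) (a : R) E
    (g : 'rV[R]_n -> 'M[R]_(p, q)) : \bar R :=
  ereal_sup [set (fnorm (g z.1 - g z.2) / fnorm (z.1 - z.2) `^ a)%:E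
    | z in [set z | [/\ E z.1, E z.2 & z.1 != z.2]]].

Definition C2alpha_loc (a : R) W u :=
  C2 W u /\
  forall K, compact K -> K `<=` W -> holder_seminorm a K (hess u) < +oo.

End Calculus.

Section Viscosity.
Variables (R : realType) (n : nat).
Implicit Types (G : symmx R n -> R) (W : set 'rV[R]_n) (u : 'rV[R]_n -> R).

(* sym_part only supplies the proof of symmetry: the Hessian of a C^2 function
   is symmetric by Schwarz's theorem, and sym_part_id applies. Solutions are
   total functions, but only their values on W matter. *)
Definition viscosity_subsolution G W u :=
  forall (phi : 'rV[R]_n -> R) (U : set 'rV[R]_n) x,
    open U -> U x -> U `<=` W -> C2 U phi ->
    phi x = u x -> (forall y, U y -> u y <= phi y) ->
    0 <= G (sym_part (hess phi x)).

Definition viscosity_supersolution G W u :=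
  forall (phi : 'rV[R]_n -> R) (U : set 'rV[R]_n) x,
    open U -> U x -> U `<=` W -> C2 U phi ->
    phi x = u x -> (forall y, U y -> phi y <= u y) ->
    G (sym_part (hess phi x)) <= 0.

Definition viscosity_solutions G W : set ('rV[R]_n -> R) :=
  [set u | [/\ forall x, W x -> {for x, continuous u},
    viscosity_subsolution G W u & viscosity_supersolution G W u]].

End Viscosity.

Section Exponents.
Variables (R : realType) (n : nat) (F : set (symmx R n -> R)).

Definition qualitative_exponents : set R :=
  [set a | 0 < a <= 1 /\
    forall G x0 (r : R), F G -> 0 < r ->
      viscosity_solutions G (eball x0 r) `<=` C2alpha_loc a (eball x0 r)].

(* The hypothesis osc < +oo makes the estimate vacuous when the right-hand side
   is infinite, whatever the value of C. *)
Definition estimate_exponents : set R :=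
  [set a | 0 < a <= 1 /\
    exists C : R, forall G x0 (r : R) u, F G -> 0 < r ->
      viscosity_solutions G (eball x0 r) u ->
      (osc (eball x0 r) u < +oo)%E ->
      twice_differentiable (eball x0 (r / 2)) u /\
      (r%:E * sup_norm (eball x0 (r / 2)) (grad u)
       + (r ^+ 2)%:E * sup_norm (eball x0 (r / 2)) (hess u)
       + (r `^ (2 + a))%:E * holder_seminorm a (eball x0 (r / 2)) (hess u)
       <= C%:E * osc (eball x0 r) u)%E].

End Exponents.

(* Main.v *)
From HB Require Import structures.
Require Import Defs.
From mathcomp Require Import all_boot all_order all_algebra.
From mathcomp Require Import all_classical all_reals all_analysis.
From mathcomp Require Import ring lra.

Set Implicit Arguments.
Unset Strict Implicit.
Unset Printing Implicit Defensive.

Import Order.TTheory GRing.Theory Num.Theory.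
Import numFieldNormedType.Exports.

Local Open Scope classical_set_scope.
Local Open Scope ring_scope.

(** Only the estimate at exponents [b < a], for a qualitative exponent [a], has
    to be proved ([qualitative_estimate]); that an estimate on all small balls
    gives local regularity with the same exponent is a covering argument
    ([estimate_sub_qualitative]), and the two suprema then agree.

    As there is a qualitative exponent, every solution is of class C^2 and
    solves its equation pointwise, so that classical arguments suffice.
    Doubling the variables gives an interior Lipschitz estimate that depends on
    the ellipticity constants only ([interior_lipschitz]). With the compactness
    of the family and the stability of viscosity solutions
    ([subsolution_stable]), solutions bounded by 1 on the unit ball form a
    compact set for locally uniform convergence ([limit_solution]).

    A limit solution is of class C^{2,a}, hence closer than [rho `^ (2 + b)] to
    its Taylor polynomial at some small scale [rho], and so are the solutions
    near it, once the polynomial is corrected by a multiple of the squared norm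
    to have a Hessian annihilated by the right operator. Compactness makes the
    scale uniform: there is [rho0 > 0] such that every normalized solution [u]
    has a quadratic approximation [P] of this quality at a scale [rho] between
    [rho0] and 1/4 ([improvement]). The rescaled remainder
    [(u - P) (rho x) / rho `^ (2 + b)] is again a normalized solution, for an
    operator of the family since the Hessian of [P] is a zero of the old one
    ([flatness_step]).

    Iterating, the Hessian of [u] at the origin is a geometric sum of bounded
    matrices plus [rho `^ b] times the Hessian of the last remainder, where
    [rho] is now the product of the scales. This last term tends to zero: the
    Hoelder seminorm of order [a] of the Hessians, about which nothing is known
    except that it is finite, does not grow along the iteration because
    [b < a]. Hence a universal bound for the Hessian ([hess_bound_iter]), first
    at the origin and then, recentring, on the half ball. Applied to the
    remainders at the scale comparable to the norm of [y], it bounds the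
    difference of the Hessians at [y] and 0 by a multiple of [fnorm y `^ b]
    ([holder0_iter]). Scaling and translating gives the estimate on all balls
    ([interior_estimate]). *)

(** * The Frobenius inner product and bilinear forms *)

Section Frobenius.
Variable R : realType.

Definition frob (p q : nat) (A B : 'M[R]_(p, q)) : R :=
  \sum_i \sum_j A i j * B i j.

Section FrobeniusNorm.
Variables p q : nat.
Implicit Types A B C : 'M[R]_(p, q).

Lemma frobC A B : frob A B = frob B A.
Proof. by apply: eq_bigr => i _; apply: eq_bigr => j _; rewrite mulrC. Qed.

Lemma frobDl A B C : frob (A + B) C = frob A C + frob B C.
Proof.
rewrite -big_split; apply: eq_bigr => i _.
by rewrite -big_split; apply: eq_bigr => j _; rewrite mxE mulrDl.
Qed.

Lemma frobZl a A B : frob (a *: A) B = a * frob A B.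
Proof.
rewrite mulr_sumr; apply: eq_bigr => i _.
by rewrite mulr_sumr; apply: eq_bigr => j _; rewrite mxE mulrA.
Qed.

Lemma frobDr A B C : frob C (A + B) = frob C A + frob C B.
Proof. by rewrite frobC frobDl !(frobC C). Qed.

Lemma frobZr a A B : frob B (a *: A) = a * frob B A.
Proof. by rewrite frobC frobZl frobC. Qed.

Lemma frobNl A B : frob (- A) B = - frob A B.
Proof. by rewrite -scaleN1r frobZl mulN1r. Qed.

Lemma frobNr A B : frob B (- A) = - frob B A.
Proof. by rewrite frobC frobNl frobC. Qed.

Lemma frob_ge0 A : 0 <= frob A A.
Proof. by apply: sumr_ge0 => i _; apply: sumr_ge0 => j _; rewrite -expr2 sqr_ge0. Qed.

Lemma frob0r A : frob A 0 = 0.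
Proof. by rewrite -(scale0r A) frobZr mul0r. Qed.

Lemma fnormE A : fnorm A = Num.sqrt (frob A A).
Proof. by []. Qed.

Lemma fnorm_ge0 A : 0 <= fnorm A.
Proof. exact: sqrtr_ge0. Qed.

Lemma sqr_fnorm A : fnorm A ^+ 2 = frob A A.
Proof. by rewrite fnormE sqr_sqrtr ?frob_ge0. Qed.

Lemma ler_fnorm A c : 0 <= c -> frob A A <= c ^+ 2 -> fnorm A <= c.
Proof. by move=> c0 h; rewrite -(ger0_norm c0) -sqrtr_sqr ler_wsqrtr. Qed.

Lemma entry_le_fnorm A i j : `|A i j| <= fnorm A.
Proof.
rewrite -sqrtr_sqr fnormE; apply: ler_wsqrtr.
rewrite /frob (bigD1 i)//= (bigD1 j)//= -expr2 -addrA lerDl addr_ge0//.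
  by apply: sumr_ge0 => k _; rewrite -expr2 sqr_ge0.
by apply: sumr_ge0 => k _; apply: sumr_ge0 => l _; rewrite -expr2 sqr_ge0.
Qed.

Lemma fnorm0_eq0 A : fnorm A = 0 -> A = 0.
Proof.
move=> A0; apply/matrixP => i j; rewrite mxE; apply/eqP.
by rewrite -normr_le0 -A0 entry_le_fnorm.
Qed.

Lemma fnorm0 : fnorm (0 : 'M[R]_(p, q)) = 0.
Proof. by rewrite fnormE -(scale0r 0) frobZl mul0r sqrtr0. Qed.

Lemma fnormZ a A : fnorm (a *: A) = `|a| * fnorm A.
Proof.
by rewrite !fnormE frobZl frobZr mulrA -expr2 sqrtrM ?sqr_ge0// sqrtr_sqr.
Qed.

Lemma fnormN A : fnorm (- A) = fnorm A.
Proof. by rewrite -scaleN1r fnormZ normrN1 mul1r. Qed.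

Lemma fnorm_distC A B : fnorm (A - B) = fnorm (B - A).
Proof. by rewrite -fnormN opprB. Qed.

(** Cauchy-Schwarz, by expanding the squared norm of
    [fnorm B *: A - fnorm A *: B]. *)
Lemma frob_le A B : frob A B <= fnorm A * fnorm B.
Proof.
set a := fnorm A; set b := fnorm B.
have a0 : 0 <= a by exact: fnorm_ge0.
have b0 : 0 <= b by exact: fnorm_ge0.
have [ab0|] := eqVneq (a * b) 0.
  move/eqP: (ab0); rewrite mulf_eq0 => /orP[] /eqP /fnorm0_eq0 ->.
    by rewrite -(scale0r 0) frobZl mul0r -/b mulr_ge0.
  by rewrite -(scale0r 0) frobZr mul0r mulr_ge0.
move=> ab0; have abp : 0 < a * b by rewrite lt_def ab0 mulr_ge0.
have := frob_ge0 (b *: A - a *: B).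
rewrite !(frobDl, frobDr, frobNl, frobNr, frobZl, frobZr) -!sqr_fnorm -/a -/b.
rewrite (frobC B A) => h.
rewrite -(ler_pM2l abp) -subr_ge0; nra.
Qed.

Lemma ler_norm_frob A B : `|frob A B| <= fnorm A * fnorm B.
Proof. by rewrite ler_norml frob_le andbT lerNl -frobNl -(fnormN A) frob_le. Qed.

Lemma ler_fnormD A B : fnorm (A + B) <= fnorm A + fnorm B.
Proof.
apply: ler_fnorm; first by rewrite addr_ge0 ?fnorm_ge0.
rewrite !(frobDl, frobDr) (frobC B A) sqrrD !sqr_fnorm.
have := frob_le A B; lra.
Qed.

Lemma ler_fnormB A B : fnorm (A - B) <= fnorm A + fnorm B.
Proof. by rewrite -(fnormN B) ler_fnormD. Qed.

Lemma ler_fnorm_dist B A C : fnorm (A - C) <= fnorm (A - B) + fnorm (B - C).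
Proof. by rewrite -[A - C](subrKA B) ler_fnormD. Qed.

Lemma fnorm_le_entries A c :
  (forall i j, `|A i j| <= c) -> 0 <= c -> fnorm A <= (p * q)%:R * c.
Proof.
move=> Ac c0; apply: ler_fnorm; first by rewrite mulr_ge0.
have -> : ((p * q)%:R * c) ^+ 2 = (p * q)%:R * ((p * q)%:R * c ^+ 2) by ring.
have : frob A A <= (p * q)%:R * c ^+ 2.
  have -> : (p * q)%:R * c ^+ 2 = \sum_(i < p) \sum_(j < q) c ^+ 2.
    rewrite (eq_bigr (fun=> c ^+ 2 *+ q)); last by move=> i _; rewrite sumr_const card_ord.
    by rewrite sumr_const card_ord -mulrnA mulr_natl mulnC.
  apply: ler_sum => i _; apply: ler_sum => j _.
  rewrite -expr2 -[A i j ^+ 2]ger0_norm ?sqr_ge0// normrX.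
  by rewrite lerXn2r ?nnegrE.
move/le_trans; apply.
have [->|pq0] := eqVneq (p * q)%N 0%N; first by rewrite !mul0r.
rewrite ler_peMl ?ler1n ?lt0n//.
by rewrite mulr_ge0 ?sqr_ge0.
Qed.

Lemma ler_mx_fnorm A : `|A| <= fnorm A.
Proof.
rewrite [`|A|]mx_normrE; apply: bigmax_le; first exact: fnorm_ge0.
by move=> -[i j] _ /=; exact: entry_le_fnorm.
Qed.

Lemma fnorm_le_mx A : fnorm A <= (p * q)%:R * `|A|.
Proof.
apply: fnorm_le_entries => // i j.
by rewrite [leRHS]mx_normrE; apply/bigmax_geP; right; exists (i, j).
Qed.

End FrobeniusNorm.

Section RowVectors.
Variable n : nat.
Implicit Types (x y z : 'rV[R]_n) (A B N : 'M[R]_n).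

(** The bilinear form of a square matrix, which need not be symmetric: the
    Hessian of a C^2 function is only known to be so after [hess_sym]. *)
Definition bform A x y : R := (x *m A *m y^T) 0 0.

Lemma bformE A x y : bform A x y = frob A (x^T *m y).
Proof.
rewrite /bform mxE /frob exchange_big; apply: eq_bigr => j _ /=.
rewrite !mxE mulr_suml; apply: eq_bigr => i _.
by rewrite mxE big_ord1 mxE; ring.
Qed.

Lemma frob_rVE x y : frob x y = (x *m y^T) 0 0.
Proof.
rewrite /frob big_ord1 mxE; apply: eq_bigr => j _.
by rewrite mxE.
Qed.

Lemma bform_frob A x y : bform A x y = frob (x *m A) y.
Proof. by rewrite frob_rVE. Qed.

Lemma fnorm_tensor x y : fnorm (x^T *m y) = fnorm x * fnorm y.
Proof.
rewrite !fnormE -sqrtrM ?frob_ge0//; congr (Num.sqrt _).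
rewrite /frob !big_ord1 mulr_suml; apply: eq_bigr => i _.
rewrite mulr_sumr; apply: eq_bigr => j _.
by rewrite !mxE !big_ord1 !mxE; ring.
Qed.

Lemma ler_norm_bform A x y : `|bform A x y| <= fnorm A * (fnorm x * fnorm y).
Proof. by rewrite bformE -fnorm_tensor ler_norm_frob. Qed.

Lemma bformDl A B x y : bform (A + B) x y = bform A x y + bform B x y.
Proof. by rewrite !bformE frobDl. Qed.
Lemma bformNl A x y : bform (- A) x y = - bform A x y.
Proof. by rewrite !bformE frobNl. Qed.
Lemma bformZl a A x y : bform (a *: A) x y = a * bform A x y.
Proof. by rewrite !bformE frobZl. Qed.
Lemma bformDxl A x y z : bform A (x + y) z = bform A x z + bform A y z.
Proof. by rewrite /bform !mulmxDl mxE. Qed.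
Lemma bformDxr A x y z : bform A z (x + y) = bform A z x + bform A z y.
Proof. by rewrite /bform linearD mulmxDr mxE. Qed.
Lemma bformZxl A a x z : bform A (a *: x) z = a * bform A x z.
Proof. by rewrite /bform -!scalemxAl mxE. Qed.
Lemma bformZxr A a x z : bform A z (a *: x) = a * bform A z x.
Proof. by rewrite /bform linearZ -scalemxAr mxE. Qed.
Lemma bformNxl A x z : bform A (- x) z = - bform A x z.
Proof. by rewrite -scaleN1r bformZxl mulN1r. Qed.
Lemma bformNxr A x z : bform A z (- x) = - bform A z x.
Proof. by rewrite -scaleN1r bformZxr mulN1r. Qed.

Lemma bform_tr A x y : bform A^T x y = bform A y x.
Proof.
transitivity ((y *m A *m x^T)^T 0 0); last by rewrite mxE.
by rewrite !trmx_mul trmxK mulmxA.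
Qed.

Lemma bform1 x y : bform 1%:M x y = frob x y.
Proof. by rewrite bform_frob mulmx1. Qed.

Lemma bform0 x y : bform 0 x y = 0.
Proof. by rewrite /bform mulmx0 mul0mx mxE. Qed.

Lemma bform_delta A i j : bform A (delta_mx 0 i) (delta_mx 0 j) = A i j.
Proof.
rewrite /bform -rowE mxE (bigD1 j)//= big1 ?addr0.
  by rewrite !mxE !eqxx mulr1.
by move=> k kj; rewrite !mxE eqxx/= (negbTE kj) mulr0.
Qed.

Lemma fnorm_delta i : fnorm (delta_mx 0 i : 'rV[R]_n) = 1.
Proof.
rewrite fnormE frob_rVE mxE (bigD1 i)//= big1 ?addr0 ?mxE ?eqxx ?mulr1 ?sqrtr1//.
by move=> k kj; rewrite !mxE eqxx/= (negbTE kj) mulr0.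
Qed.

Lemma psdmx_tr_ge0 N : psdmx N -> 0 <= \tr N.
Proof.
move=> N0; apply: sumr_ge0 => i _.
by have := N0 (delta_mx 0 i); rewrite -/(bform _ _ _) bform_delta.
Qed.

(** Conjugating by the projection [Q] onto the hyperplane orthogonal to [e]
    keeps [N] positive semidefinite, and the trace of [Q *m N *m Q] is
    [\tr N - bform N e e]. *)
Lemma psdmx_bform_le_tr N e : psdmx N -> fnorm e = 1 -> bform N e e <= \tr N.
Proof.
move=> N0 e1; set Q := 1%:M - e^T *m e.
have ee : e *m e^T = 1%:M.
  apply/matrixP => i j; rewrite !ord1 -frob_rVE -sqr_fnorm e1 expr1n.
  by rewrite mxE eqxx.
have QQ : Q *m Q = Q.
  rewrite /Q mulmxBl mul1mx mulmxBr mulmx1 -mulmxA (mulmxA e) ee mul1mx.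
  by rewrite subrr subr0.
have QT : Q^T = Q by rewrite /Q raddfB /= trmx1 trmx_mul trmxK.
have : psdmx (Q *m N *m Q).
  move=> x; have := N0 (x *m Q); rewrite trmx_mul QT.
  by rewrite !mulmxA.
move=> /psdmx_tr_ge0; rewrite mxtrace_mulC mulmxA QQ /Q mulmxBl mul1mx.
rewrite raddfB /= subr_ge0 -mulmxA mxtrace_mulC /bform.
by rewrite /mxtrace big_ord1.
Qed.

Lemma mxtrace1 : \tr (1%:M : 'M[R]_n) = n%:R.
Proof. by rewrite mxtrace_scalar. Qed.

End RowVectors.
End Frobenius.

(** * Euclidean balls and restrictions to lines *)

Section Calculus.
Variables (R : realType) (n : nat).
Implicit Types (u v : 'rV[R]_n -> R) (x y z e : 'rV[R]_n) (A : 'M[R]_n).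

Lemma eballE x y r : eball x r y = (fnorm (y - x) < r).
Proof. by []. Qed.

Lemma eball_center x r : 0 < r -> eball x r x.
Proof. by move=> r0; rewrite eballE subrr fnorm0. Qed.

Lemma near_fnorm x r : 0 < r -> \forall y \near x, fnorm (y - x) < r.
Proof.
move=> r0.
have N0 : 0 < (1 * n).+1%:R :> R by rewrite ltr0n.
apply/nbhs_ballP; exists (r / (1 * n).+1%:R) => /=; first by rewrite divr_gt0.
move=> y; rewrite -ball_normE /= => h.
rewrite -fnormN opprB (le_lt_trans (fnorm_le_mx _))//.
rewrite ltr_pdivlMr// in h.
apply: le_lt_trans h; rewrite mulrC ler_wpM2l//.
by rewrite ler_nat.
Qed.

Lemma nbhs_eball x r : 0 < r -> nbhs x (eball x r).
Proof. exact: near_fnorm. Qed.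

Lemma continuous_fnorm p q : continuous (@fnorm R p q).
Proof.
move=> A; apply/(@cvgrPdist_le R R^o _ (nbhs A)) => /= eps eps0.
have N0 : 0 < (p * q).+1%:R :> R by rewrite ltr0n.
apply/nbhs_ballP; exists (eps / (p * q).+1%:R) => /=; first by rewrite divr_gt0.
move=> B; rewrite -ball_normE /= => h.
have h2 : fnorm (A - B) <= eps.
  rewrite (le_trans (fnorm_le_mx _))// ltW//.
  rewrite ltr_pdivlMr// in h.
  by apply: le_lt_trans h; rewrite mulrC ler_wpM2l// ler_nat.
have := ler_fnorm_dist B A 0; have := ler_fnorm_dist A B 0.
rewrite !subr0 (fnorm_distC B A) => h3 h4.
rewrite ler_norml; apply/andP; split; lra.
Qed.

Lemma continuous_subr_cst x : continuous (fun y => y - x).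
Proof.
move=> y; apply: (@cvgB R 'rV[R]_n _ (nbhs y) _ id (cst x)); first exact: cvg_id.
exact: cvg_cst.
Qed.

Lemma open_eball x r : open (eball x r).
Proof.
have -> : eball x r = (fun y => fnorm (y - x)) @^-1` [set t | t < r] by [].
apply: open_comp; last exact: open_lt.
move=> y _; apply: continuous_comp; last exact: continuous_fnorm.
exact: continuous_subr_cst.
Qed.

Lemma nbhs_eballP x (P : set 'rV[R]_n) :
  nbhs x P <-> exists2 r, 0 < r & eball x r `<=` P.
Proof.
split=> [/nbhs_ballP[r /= r0 h]|[r r0 h]].
  exists r => // y; rewrite eballE => yr; apply: h.
  by rewrite -ball_normE /= distrC (le_lt_trans (ler_mx_fnorm _)).
by apply: filterS h _; exact: nbhs_eball.
Qed.

Definition cball x (r : R) : set 'rV[R]_n := [set y | fnorm (y - x) <= r].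

Lemma cballE x y r : cball x r y = (fnorm (y - x) <= r).
Proof. by []. Qed.

Lemma compact_cball x r : compact (cball x r).
Proof.
apply: bounded_closed_compact.
  exists (r + fnorm x); split; first exact: num_real.
  move=> M hM y /=; rewrite cballE => yr; rewrite (le_trans (ler_mx_fnorm _))// ltW//.
  apply: le_lt_trans hM; rewrite -{1}(subrK x y).
  by rewrite (le_trans (ler_fnormD _ _))// lerD2r.
have -> : cball x r = (fun y => fnorm (y - x)) @^-1` [set t | t <= r] by [].
apply: closed_comp; last exact: closed_le.
move=> y _; apply: continuous_comp; last exact: continuous_fnorm.
exact: continuous_subr_cst.
Qed.

Lemma continuous_eballP (f : 'rV[R]_n -> R) x : {for x, continuous f} <->
  forall eps, 0 < eps -> exists2 d, 0 < d &
    forall y, eball x d y -> `|f x - f y| < eps.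
Proof.
split=> [cf eps eps0|h].
  have /nbhs_eballP[d d0 hd] : nbhs x [set y | `|f x - f y| < eps].
    exact: (@cvgr_dist_lt R R^o _ (nbhs x) _ _ _ cf _ eps0).
  by exists d.
apply/(@cvgrPdist_lt R R^o _ (nbhs x)) => /= eps /h[d d0 hd].
by apply/nbhs_eballP; exists d.
Qed.

Lemma continuous_mx_eballP p q (f : 'rV[R]_n -> 'M[R]_(p, q)) x :
  {for x, continuous f} <->
  forall eps, 0 < eps -> exists2 d, 0 < d &
    forall y, eball x d y -> fnorm (f x - f y) < eps.
Proof.
split=> [cf eps eps0|h].
  have N0 : 0 < (p * q).+1%:R :> R by rewrite ltr0n.
  have eN0 : 0 < eps / (p * q).+1%:R by rewrite divr_gt0.
  have /nbhs_eballP[d d0 hd] : nbhs x [set y | `|f x - f y| < eps / (p * q).+1%:R].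
    exact: (@cvgr_dist_lt R 'M[R]_(p, q) _ (nbhs x) _ _ _ cf _ eN0).
  exists d => // y /hd /=; rewrite ltr_pdivlMr// => fxy.
  rewrite (le_lt_trans (fnorm_le_mx _))//; apply: le_lt_trans fxy.
  by rewrite mulrC ler_wpM2l// ler_nat.
apply/(@cvgrPdist_lt R 'M[R]_(p, q) _ (nbhs x)) => /= eps /h[d d0 hd].
apply/nbhs_eballP; exists d => // y /hd.
by apply: le_lt_trans; exact: ler_mx_fnorm.
Qed.

(** A named function, to carry the linear structure that the differential of a
    real-valued function has. *)
Definition frobr e := fun x => frob x e.

Lemma frobr_linear e : linear_for *%R (frobr e).
Proof. by move=> a x y; rewrite /frobr frobDl frobZl. Qed.

HB.instance Definition _ e :=
  GRing.isLinear.Build R 'rV[R]_n R^o *%R (frobr e) (frobr_linear e).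

Lemma continuous_frobr e : continuous (frobr e).
Proof.
move=> x; apply/continuous_eballP => eps eps0.
exists (eps / (fnorm e + 1)); first by rewrite divr_gt0 ?ltr_wpDl ?fnorm_ge0.
move=> y; rewrite eballE ltr_pdivlMr ?ltr_wpDl ?fnorm_ge0// => h.
rewrite /frobr -frobNl -frobDl (le_lt_trans (ler_norm_frob _ _))//.
rewrite fnorm_distC; apply: le_lt_trans h; rewrite ler_wpM2l ?fnorm_ge0//.
by rewrite lerDl.
Qed.

Lemma diff_grad u x : differentiable (u : _ -> R^o) x ->
  forall e, 'd (u : _ -> R^o) x e = frob e (grad u x).
Proof.
move=> du e; rewrite [in LHS](row_sum_delta e) linear_sum /frob big_ord1.
apply: eq_bigr => i _; rewrite linearZ mxE.
by rewrite deriveE.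
Qed.

Lemma diff_hess u x e : 'd (grad u) x e = e *m hess u x.
Proof. by rewrite /hess /jacobian mul_rV_lin1. Qed.

Lemma is_diff_line x e (t : R) :
  is_diff t (fun s : R => x + s *: e) (fun s : R => s *: e).
Proof.
have := is_diffD (is_diff_cst x t) (is_diff_scalel t e).
by rewrite add0r.
Qed.

Lemma is_derive_line u x e t : differentiable (u : _ -> R^o) (x + t *: e) ->
  is_derive t 1 (fun s => u (x + s *: e) : R^o) (frob e (grad u (x + t *: e))).
Proof.
move=> du; have dl := is_diff_line x e t.
have dc : differentiable ((u : _ -> R^o) \o (fun s : R => x + s *: e)) t.
  by apply: differentiable_comp.
split; first exact: diff_derivable.
rewrite deriveE// diff_comp//= diff_grad// //=.
by rewrite diff_val scale1r.
Qed.

Lemma is_derive_line_grad u x e z t : differentiable (grad u) (x + t *: e) ->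
  is_derive t 1 (fun s => frob z (grad u (x + s *: e)) : R^o)
    (bform (hess u (x + t *: e)) e z).
Proof.
move=> du; have dl := is_diff_line x e t.
have dg : differentiable (grad u \o (fun s : R => x + s *: e)) t.
  by apply: differentiable_comp.
have df y : differentiable (frobr z : _ -> R^o) y.
  by apply: linear_differentiable; exact: continuous_frobr.
have -> : (fun s => frob z (grad u (x + s *: e)) : R^o) =
  (frobr z : _ -> R^o) \o (grad u \o (fun s : R => x + s *: e)).
  by apply/funext => s; rewrite /= /frobr frobC.
have dc : differentiable ((frobr z : _ -> R^o) \o (grad u \o (fun s : R => x + s *: e))) t.
  by apply: differentiable_comp.
split; first exact: diff_derivable.
rewrite deriveE// diff_comp//= diff_lin; last exact: continuous_frobr.
by rewrite diff_comp//= diff_hess diff_val scale1r /frobr -bform_frob.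
Qed.

End Calculus.

(** * Second-order Taylor formula and symmetry of the Hessian *)

Section Taylor.
Variables (R : realType) (n : nat).
Implicit Types (u v : 'rV[R]_n -> R) (x y z e : 'rV[R]_n) (A : 'M[R]_n).

Lemma mvt0 (f df : R -> R) (b : R) : 0 <= b ->
  (forall t, 0 <= t <= b -> is_derive t 1 (f : R -> R^o) (df t)) ->
  exists2 c, 0 <= c <= b & f b - f 0 = df c * b.
Proof.
move=> b0 h.
have [] := @MVT_segment R f df 0 b b0.
- by move=> t; rewrite in_itv/= => /andP[t0 tb]; apply: h; rewrite !ltW.
- apply: derivable_within_continuous => t; rewrite in_itv/= => /h h'.
  exact: ex_derive.
- by move=> c; rewrite in_itv/= subr0 => ? ?; exists c.
Qed.

(** The mean value theorem is applied along the segment from [x] to [x + e],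
    to the Taylor remainder of the restriction of [u] and then to that of its
    derivative. The form of the bound suits both uses: with [w] small by
    continuity of the Hessian, and with [w] a power of [fnorm e]. *)
Lemma taylor2 u x e (w : R) :
  (forall t : R, 0 <= t <= 1 -> differentiable (u : _ -> R^o) (x + t *: e) /\
                            differentiable (grad u) (x + t *: e)) ->
  (forall t : R, 0 <= t <= 1 ->
    `|bform (hess u (x + t *: e)) e e - bform (hess u x) e e| <= w) ->
  `|u (x + e) - u x - frob e (grad u x) - bform (hess u x) e e / 2| <= w.
Proof.
move=> du hw; set b0 := bform (hess u x) e e; set g0 := frob e (grad u x).
pose g t := u (x + t *: e) - t * g0 - t ^+ 2 / 2 * b0.
pose k t := frob e (grad u (x + t *: e)) - t * b0.
have w0 : 0 <= w by rewrite (le_trans _ (hw 0 _))// lexx ler01.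
have [||c /andP[c0 c1] gc] := @mvt0 g (fun t => frob e (grad u (x + t *: e)) - g0 - t * b0) 1.
- by [].
- move=> t /du[du1 _].
  have d1 := is_derive_line du1.
  rewrite /g; apply: is_derive_eq.
  move: (frob e (grad u (x + t *: e))) => q.
  by rewrite !scaler0 -![_ *: _]/(_ * _); field.
have [||c' /andP[c'0 c'c] kc] := @mvt0 k (fun t => bform (hess u (x + t *: e)) e e - b0) c.
- by [].
- move=> t /andP[t0 tc]; have [|_ du2] := du t; first by rewrite t0 (le_trans tc).
  have d2 := is_derive_line_grad e du2.
  rewrite /k; apply: is_derive_eq.
  move: (bform (hess u (x + t *: e)) e e) => q.
  by rewrite !scaler0 -![_ *: _]/(_ * _); ring.
have := hw c'; rewrite c'0 (le_trans c'c)// => /(_ isT) hc'.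
have -> : u (x + e) - u x - g0 - b0 / 2 = (bform (hess u (x + c' *: e)) e e - b0) * c.
  rewrite -kc /k scale0r addr0 -/g0.
  move: gc; rewrite /g scale1r scale0r addr0 mulr1 => gc.
  by lra.
rewrite normrM (ger0_norm c0) -[leRHS]mulr1.
by rewrite ler_pM.
Qed.

(** The mean value theorem in the direction [z], then in the direction [e]. *)
Lemma second_difference u x e z (d h : R) :
  (forall y, eball x d y -> differentiable (u : _ -> R^o) y /\
                            differentiable (grad u) y) ->
  fnorm e <= 1 -> fnorm z <= 1 -> 0 < h -> 2 * h < d ->
  exists2 y, eball x d y &
  u (x + h *: e + h *: z) - u (x + h *: e) - (u (x + h *: z) - u x) =
    h ^+ 2 * bform (hess u y) e z.
Proof.
move=> du e1 z1 h0 hd.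
have inb s t : 0 <= s <= h -> 0 <= t <= h -> eball x d (x + s *: e + t *: z).
  move=> /andP[s0 sh] /andP[t0 th]; rewrite eballE -(addrA x) (addrC x) addrK.
  rewrite (le_lt_trans (ler_fnormD _ _))//; apply: le_lt_trans hd.
  rewrite !fnormZ !ger0_norm// mulr2n mulrDl mul1r.
  by apply: lerD; rewrite -[leRHS]mulr1 ler_pM ?fnorm_ge0.
have h00 : (0 : R) <= 0 <= h by rewrite lexx ltW.
have hh : (0 : R) <= h <= h by rewrite lexx ltW.
have [||s sh fs] := @mvt0 (fun t => u (x + h *: e + t *: z) - u (x + t *: z))
  (fun t => frob z (grad u (x + h *: e + t *: z)) - frob z (grad u (x + t *: z))) h.
- exact: ltW.
- move=> t th; have [d1 _] := du _ (inb _ _ hh th).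
  have [] := du (x + t *: z); first by have := inb _ _ h00 th; rewrite scale0r addr0.
  move=> d2 _; have i1 := is_derive_line d1; have i2 := is_derive_line d2.
  by apply: is_derive_eq.
have [||t th ft] := @mvt0 (fun t => frob z (grad u (x + s *: z + t *: e)))
  (fun t => bform (hess u (x + s *: z + t *: e)) e z) h.
- exact: ltW.
- move=> t th; have [_ d1] := du _ (inb _ _ th sh).
  by apply: is_derive_line_grad; rewrite addrAC.
exists (x + s *: z + t *: e); first by rewrite addrAC; exact: inb.
move: fs; rewrite !scale0r !addr0 => fs.
have -> : forall a b c d : R, a - b - (c - d) = a - c - (b - d) by move=> *; ring.
move: ft; rewrite scale0r addr0 => ft.
by rewrite fs (addrAC x) ft expr2; ring.
Qed.

(** Schwarz's theorem: the second difference is symmetric in the two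
    directions, and tends to either mixed derivative after division by the
    square of the step. *)
Lemma hess_sym W u x : open W -> W x -> C2 W u -> (hess u x)^T = hess u x.
Proof.
move=> oW Wx [du cu]; apply/matrixP => i j; rewrite mxE.
rewrite -[LHS]bform_delta -[RHS]bform_delta.
set e := delta_mx 0 i; set z := delta_mx 0 j.
apply/eqP; rewrite -subr_eq0 -normr_le0; apply/ler_addgt0Pl => eps eps0.
rewrite addr0.
have /nbhs_eballP[d1 d10 Wd] : nbhs x W by exact: open_nbhs_nbhs.
have eps2 : 0 < eps / 2 by rewrite divr_gt0.
have [d2 d20 hd2] := (continuous_mx_eballP (hess u) x).1 (cu x Wx) _ eps2.
pose d := Num.min d1 d2; have d0 : 0 < d by rewrite lt_min d10.
have duW y : eball x d y -> differentiable (u : _ -> R^o) y /\ differentiable (grad u) y.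
  by rewrite eballE lt_min => /andP[yd1 _]; apply: du; exact: Wd.
have h0 : 0 < d / 4 by rewrite divr_gt0.
have hd : 2 * (d / 4) < d by rewrite /=; lra.
have e1 : fnorm e <= 1 by rewrite fnorm_delta.
have z1 : fnorm z <= 1 by rewrite fnorm_delta.
clearbody e z.
have [y yd Ey] := second_difference duW e1 z1 h0 hd.
have [y' yd' Ey'] := second_difference duW z1 e1 h0 hd.
have E : bform (hess u y) e z = bform (hess u y') z e.
  have h2 : (d / 4) ^+ 2 != 0 by rewrite expf_neq0// gt_eqF.
  apply: (mulfI h2); rewrite -Ey -Ey'.
  by rewrite addrAC [x + _ + _]addrAC; ring.
have near2 t : eball x d t -> forall p q, fnorm p <= 1 -> fnorm q <= 1 ->
    `|bform (hess u x) p q - bform (hess u t) p q| <= eps / 2.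
  rewrite eballE lt_min => /andP[_ td2] p q p1 q1.
  rewrite -bformNl -bformDl (le_trans (ler_norm_bform _ _ _))//.
  rewrite -[leRHS]mulr1; apply: ler_pM; rewrite ?mulr_ge0 ?fnorm_ge0//.
    by apply: ltW; exact: hd2.
  by rewrite -[leRHS]mulr1 ler_pM ?fnorm_ge0.
have /ler_normlP[n1 n2] := near2 y yd e z e1 z1.
have /ler_normlP[n3 n4] := near2 y' yd' z e z1 e1.
move: E n1 n2 n3 n4; clear.
move: (hess u) => H.
move: (bform (H y) e z) (bform (H y') z e) => p q ->.
by move=> n1 n2 n3 n4; apply/ler_normlP; split; lra.
Qed.

End Taylor.

(** * Changes of variables *)

Section Transform.
Variables (R : realType) (n : nat).
Implicit Types (u v : 'rV[R]_n -> R) (x y z e b w : 'rV[R]_n) (A H : 'M[R]_n).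

Lemma is_diff_eps (V W : normedModType R) (f : V -> W) (df : {linear V -> W}) (x : V) :
  continuous df ->
  (forall eps : R, 0 < eps -> exists2 d : R, 0 < d &
    forall h, `|h| < d -> `|f (h + x) - (f x + df h)| <= eps * `|h|) ->
  is_diff x f df.
Proof.
move=> cdf h.
have E : f \o shift x = cst (f x) + df +o_ 0 id.
  apply/eqaddoP => eps eps0; have [d d0 hd] := h _ eps0.
  apply/nbhs_ballP; exists d => //= y; rewrite -ball_normE /= sub0r normrN.
  by move=> /hd.
have D := diff_unique cdf E.
by split=> //; apply/diff_locallyP; rewrite D.
Qed.

(** Gradients are computed from the differential on a neighbourhood only, so
    the Hessian of a transformed function needs locality of [is_diff]. *)
Lemma is_diff_near (V W : normedModType R) (f g df : V -> W) (x : V) :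
  (\forall y \near x, f y = g y) -> is_diff x g df -> is_diff x f df.
Proof.
move=> fg dg.
have k0 : is_diff x (f - g) (\0 : {linear V -> W}).
  apply: is_diff_eps; first exact: cst_continuous.
  move=> eps eps0; move/nbhs_ballP: (fg) => [d /= d0 hd]; exists d => // h hd'.
  rewrite !fctE (hd (h + x)) ?(nbhs_singleton fg) ?subrr /=.
    by rewrite addr0 subrr normr0 mulr_ge0// ltW.
  by rewrite -ball_normE /= opprD addrCA subrr addr0 normrN.
have := is_diffD k0 dg; rewrite subrK.
by move=> D; apply: is_diff_eq; rewrite add0r.
Qed.

Lemma fnorm_mulmx_le x A : fnorm (x *m A) <= fnorm A * fnorm x.
Proof.
have [->|x0] := eqVneq (fnorm (x *m A)) 0.
  by rewrite mulr_ge0 ?fnorm_ge0.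
have xp : 0 < fnorm (x *m A) by rewrite lt_def x0 fnorm_ge0.
rewrite -(ler_pM2r xp) -expr2 sqr_fnorm -bform_frob -mulrA.
by rewrite (le_trans (ler_norm _)) ?ler_norm_bform.
Qed.

Lemma continuous_mulmxr A : continuous (mulmxr A : 'rV[R]_n -> 'rV[R]_n).
Proof.
move=> x; apply/continuous_mx_eballP => eps eps0.
exists (eps / (fnorm A + 1)); first by rewrite divr_gt0 ?ltr_wpDl ?fnorm_ge0.
move=> y; rewrite eballE ltr_pdivlMr ?ltr_wpDl ?fnorm_ge0// => h.
rewrite /= -mulmxBl (le_lt_trans (fnorm_mulmx_le _ _))//.
by rewrite fnorm_distC; move: (fnorm_ge0 (y - x)) h; nra.
Qed.

Lemma is_diff_mulmxr A x : is_diff x (mulmxr A : 'rV[R]_n -> 'rV[R]_n) (mulmxr A).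
Proof.
apply: DiffDef; first exact/linear_differentiable/continuous_mulmxr.
by rewrite diff_lin//; exact: continuous_mulmxr.
Qed.

Lemma differentiable_is_diff u x : differentiable (u : _ -> R^o) x ->
  is_diff x (u : _ -> R^o) (frobr (grad u x) : _ -> R^o).
Proof.
by move=> du; apply: DiffDef => //; apply/funext => e; exact: diff_grad.
Qed.

Lemma is_diff_grad u x w : is_diff x (u : _ -> R^o) (frobr w : _ -> R^o) ->
  grad u x = w.
Proof.
move=> du; apply/rowP => i; rewrite mxE deriveE// diff_val /= /frobr.
by rewrite frob_rVE -rowE !mxE.
Qed.

Lemma is_diff_hess u x H : is_diff x (grad u) (mulmxr H) -> hess u x = H.
Proof.
move=> du; apply/row_matrixP => i; rewrite !rowE.
by rewrite -diff_hess diff_val.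
Qed.

Lemma differentiable_is_diff_grad u x : differentiable (grad u) x ->
  is_diff x (grad u) (mulmxr (hess u x)).
Proof.
by move=> du; apply: DiffDef => //; apply/funext => e; exact: diff_hess.
Qed.

Definition quad (c0 : R) b A y := c0 + frob y b + bform A y y / 2.

Lemma quad00 c0 y : quad c0 0 0 y = c0.
Proof. by rewrite /quad frob0r bform0 mul0r !addr0. Qed.

Lemma is_diff_quad c0 b A y : A^T = A ->
  is_diff y (quad c0 b A : _ -> R^o) (frobr (b + y *m A) : _ -> R^o).
Proof.
move=> sA; apply: is_diff_eps; first exact: continuous_frobr.
move=> eps eps0; pose K := fnorm A * (1 * n)%:R ^+ 2 + 1.
have K0 : 0 < K by rewrite ltr_wpDl// mulr_ge0 ?fnorm_ge0 ?sqr_ge0.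
exists (eps / K); first by rewrite divr_gt0.
move=> h; rewrite ltr_pdivlMr// => hK.
have -> : quad c0 b A (h + y) - (quad c0 b A y + frobr (b + y *m A) h) = bform A h h / 2.
  rewrite /quad /frobr frobDr (frobC h (y *m A)) -bform_frob !frobDl.
  rewrite bformDxl !bformDxr -[bform A h y]bform_tr sA; by field.
have h1 := ler_norm_bform A h h; have h2 := fnorm_le_mx h.
have h3 : `|bform A h h| <= K * (`|h| * `|h|).
  rewrite (le_trans h1)// /K mulrDl mul1r ler_wpDr ?mulr_ge0//.
  rewrite -mulrA ler_wpM2l ?fnorm_ge0// expr2 mulrACA.
  by rewrite ler_pM ?fnorm_ge0.
have h6 : `|bform A h h / 2| <= eps * `|h|; last by [].
rewrite normrM [`|2^-1|]ger0_norm//.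
have h4 : `|h| * K * `|h| <= eps * `|h| by rewrite ler_wpM2r// ltW.
have h5 := normr_ge0 (bform A h h).
move: h3 h4; rewrite mulrCA mulrA; lra.
Qed.

Lemma is_diff_shift (x0 : 'rV[R]_n) (rho : R) y :
  is_diff y (fun y => x0 + rho *: y) (fun e => rho *: e).
Proof.
have := is_diffD (is_diff_cst x0 y) (is_diff_scaler rho y).
by rewrite add0r.
Qed.

(** All the changes of variables and of unknown below, test functions included,
    are instances of this one, whose derivatives are computed once. *)
Definition affq u x0 (rho c c0 : R) b A : 'rV[R]_n -> R :=
  fun y => c * u (x0 + rho *: y) + quad c0 b A y.

Lemma is_diff_affq u x0 rho c c0 b A y : A^T = A ->
  differentiable (u : _ -> R^o) (x0 + rho *: y) ->
  is_diff y (affq u x0 rho c c0 b A : _ -> R^o)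
    (frobr ((c * rho) *: grad u (x0 + rho *: y) + (b + y *m A)) : _ -> R^o).
Proof.
move=> sA /differentiable_is_diff du; have ds := is_diff_shift x0 rho y.
have dc := is_diffZ c (is_diff_comp ds du).
have := is_diffD dc (is_diff_quad c0 b y sA).
move=> D; apply: (is_diff_eq D); apply/funext => e /=.
rewrite -[LHS]/(c * frob (rho *: e) (grad u (x0 + rho *: y)) +
  frob e (b + y *m A)).
by rewrite /frobr [RHS]frobDr frobZr frobZl mulrA.
Qed.

Lemma grad_affq u x0 rho c c0 b A y : A^T = A ->
  differentiable (u : _ -> R^o) (x0 + rho *: y) ->
  grad (affq u x0 rho c c0 b A) y =
    (c * rho) *: grad u (x0 + rho *: y) + (b + y *m A).
Proof. by move=> sA du; apply: is_diff_grad; exact: is_diff_affq. Qed.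

Lemma near_shift_open x0 rho y (W : set 'rV[R]_n) : open W ->
  W (x0 + rho *: y) -> \forall y' \near y, W (x0 + rho *: y').
Proof.
move=> oW Wy; have ds := is_diff_shift x0 rho y.
have : {for y, continuous (fun y => x0 + rho *: y)}.
  by apply: differentiable_continuous; exact: ex_diff.
by apply; exact: open_nbhs_nbhs.
Qed.

Lemma is_diff_grad_affq W u x0 rho c c0 b A y : A^T = A -> open W ->
  twice_differentiable W u -> W (x0 + rho *: y) ->
  is_diff y (grad (affq u x0 rho c c0 b A))
    (mulmxr ((c * rho ^+ 2) *: hess u (x0 + rho *: y) + A)).
Proof.
move=> sA oW du Wy; have [_ /differentiable_is_diff_grad dg] := du _ Wy.
have ds := is_diff_shift x0 rho y.
have dc := is_diffZ (c * rho) (is_diff_comp ds dg).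
have dq := is_diffD (is_diff_cst b y) (is_diff_mulmxr A y).
apply: (is_diff_near _ (is_diff_eq (is_diffD dc dq) _)).
  apply: filterS (near_shift_open oW Wy) => y' /du[d1 _].
  by rewrite grad_affq.
apply/funext => e /=; rewrite !fctE /= add0r mulmxDr -scalemxAl -scalemxAr.
by rewrite scalerA expr2 mulrA.
Qed.

Lemma hess_affq W u x0 rho c c0 b A y : A^T = A -> open W ->
  twice_differentiable W u -> W (x0 + rho *: y) ->
  hess (affq u x0 rho c c0 b A) y = (c * rho ^+ 2) *: hess u (x0 + rho *: y) + A.
Proof.
by move=> sA oW du Wy; apply: is_diff_hess; exact: is_diff_grad_affq oW du Wy.
Qed.

Lemma C2_affq W u x0 rho c c0 b A : A^T = A -> open W -> C2 W u ->
  C2 [set y | W (x0 + rho *: y)] (affq u x0 rho c c0 b A).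
Proof.
move=> sA oW [du cu]; split=> y /= Wy.
  split; first exact: (@ex_diff _ _ _ _ _ _ _ (is_diff_affq c c0 b sA (du _ Wy).1)).
  exact: (@ex_diff _ _ _ _ _ _ _ (is_diff_grad_affq c c0 b sA oW du Wy)).
apply/continuous_mx_eballP => eps eps0.
have K0 : 0 < `|c * rho ^+ 2| + 1 by rewrite ltr_wpDl.
have [d d0 hd] := (continuous_mx_eballP (hess u) _).1 (cu _ Wy) _ (divr_gt0 eps0 K0).
have oWd : open (W `&` eball (x0 + rho *: y) d).
  by apply: openI => //; exact: open_eball.
have Wdy : (W `&` eball (x0 + rho *: y) d) (x0 + rho *: y).
  by split=> //; exact: eball_center.
have /nbhs_eballP[r r0 hr] := near_shift_open oWd Wdy.
exists r; first exact: r0.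
move=> y' /hr [Wy' dy'].
have h := hd _ dy'.
rewrite ltr_pdivlMr in h; last exact: K0.
rewrite (hess_affq c c0 b sA oW du Wy) (hess_affq c c0 b sA oW du Wy').
move: h; move: (hess u _) (hess u _) => H H' h.
rewrite opprD addrACA subrr addr0 -scalerBr fnormZ.
apply: le_lt_trans h; rewrite mulrC ler_wpM2l ?fnorm_ge0//.
by rewrite lerDl.
Qed.

Lemma open_shift x0 rho (W : set 'rV[R]_n) : open W ->
  open [set y | W (x0 + rho *: y)].
Proof. by move=> oW; rewrite openE => y; exact: near_shift_open. Qed.

End Transform.

(** * Uniform ellipticity *)

Section Ellipticity.
Variables (R : realType) (n : nat).
Implicit Types (A M N : symmx R n) (G : symmx R n -> R) (lam Lam : R).

Lemma symmx_tr A : (A : 'M[R]_n)^T = A.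
Proof. by apply/eqP; case: A. Qed.

Lemma sym_part_symmx A : sym_part A = A.
Proof. by apply: val_inj; apply: sym_part_id; exact: symmx_tr. Qed.

(** Stated apart from [elliptic] because it is visibly invariant under the
    reflection [M |-> - M] that exchanges subsolutions and supersolutions. *)
Definition uniform_ellipticity lam Lam G := forall M N, psdmx N ->
  lam * \tr (N : 'M[R]_n) <= G (M + N) - G M <= Lam * \tr (N : 'M[R]_n).

Definition idsym : symmx R n := sym_part 1%:M.

Lemma idsymE : idsym = 1%:M :> 'M[R]_n.
Proof. by apply: sym_part_id; exact: trmx1. Qed.

Lemma bform_idsym (c : R) (x : 'rV[R]_n) :
  bform (c *: idsym : symmx R n) x x = c * fnorm x ^+ 2.
Proof.
rewrite -[symmx_val (c *: idsym)]/(c *: symmx_val idsym) idsymE.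
by rewrite bformZl bform1 sqr_fnorm.
Qed.

Lemma psdmxE (N : 'M[R]_n) : psdmx N <-> forall x, 0 <= bform N x x.
Proof. by []. Qed.

Lemma psd_idsym (c : R) : 0 <= c -> psdmx (c *: idsym : symmx R n).
Proof.
by move=> c0; apply/psdmxE => x; rewrite bform_idsym mulr_ge0 ?sqr_ge0.
Qed.

Lemma tr_idsym (c : R) : \tr (c *: idsym : symmx R n) = c * n%:R.
Proof.
rewrite -[symmx_val (c *: idsym)]/(c *: symmx_val idsym) idsymE.
by rewrite linearZ /= mxtrace1.
Qed.

(** Turns closeness of two Hessians into an order relation, to which the
    monotonicity [elliptic_le] applies. *)
Lemma psd_idsymB (c : R) A : fnorm A <= c -> psdmx (c *: idsym - A : symmx R n).
Proof.
move=> Ac; apply/psdmxE => x.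
rewrite -[symmx_val (_ - _)]/(symmx_val (c *: idsym) - symmx_val A).
rewrite bformDl bformNl bform_idsym subr_ge0 (le_trans (ler_norm _))//.
rewrite (le_trans (ler_norm_bform _ _ _))// -expr2.
by rewrite ler_wpM2r ?sqr_ge0.
Qed.

Lemma elliptic_le lam Lam G M N : 0 < lam -> uniform_ellipticity lam Lam G ->
  psdmx (N - M : symmx R n) -> G M <= G N.
Proof.
move=> lam0 eG NM; have /andP[h _] := eG M _ NM.
rewrite (addrC M) subrK in h; rewrite -subr_ge0 (le_trans _ h)//.
by rewrite mulr_ge0 ?(ltW lam0)// psdmx_tr_ge0.
Qed.

Lemma elliptic_idsym lam Lam G M (c : R) : uniform_ellipticity lam Lam G -> 0 <= c ->
  lam * (c * n%:R) <= G (M + c *: idsym) - G M <= Lam * (c * n%:R).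
Proof. by move=> eG c0; have := eG M _ (psd_idsym c0); rewrite tr_idsym. Qed.

(** Strict monotonicity along the identity: a small value of [G] is corrected
    by a small multiple of the identity. *)
Lemma elliptic_zero lam Lam G M (d : R) : (0 < n)%N -> 0 < lam ->
  uniform_ellipticity lam Lam G -> 0 <= d -> `|G M| <= lam * (d * n%:R) ->
  exists2 s : R, `|s| <= d & G (M + s *: idsym) = 0.
Proof.
move=> n0 lam0 eG d0 GM.
have [s sd Gs] : exists2 s : R, s \in `[- d, d] & G (M + s *: idsym) = 0.
  (* the intermediate value theorem; along the identity the operator is even
     Lipschitz continuous, by the upper ellipticity bound *)
  apply: IVT; first by rewrite ge0_cp.
  - apply: continuous_subspaceT => s.
    have K0 : 0 < `|Lam| * n%:R + 1 by rewrite ltr_wpDl// mulr_ge0.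
    have lip s1 s2 : s1 <= s2 ->
      `|G (M + s1 *: idsym) - G (M + s2 *: idsym)| <= `|Lam| * n%:R * (s2 - s1).
      move=> s12; have := elliptic_idsym (M + s1 *: idsym) eG (_ : 0 <= s2 - s1).
      rewrite subr_ge0 => /(_ s12).
      rewrite -addrA -scalerDl (addrC s1) subrK => /andP[h1 h2].
      rewrite distrC ger0_norm; last first.
        apply: le_trans h1; rewrite mulr_ge0 ?(ltW lam0)//.
        by rewrite mulr_ge0 ?subr_ge0.
      apply: (le_trans h2); rewrite -mulrA [n%:R * _]mulrC ler_wpM2r ?ler_norm//.
      by rewrite mulr_ge0 ?subr_ge0.
    apply/(@cvgrPdist_lt R R^o _ (nbhs s)) => /= eps eps0.
    apply/nbhs_ballP; exists (eps / (`|Lam| * n%:R + 1)) => /=; first by rewrite divr_gt0.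
    move=> t; rewrite -ball_normE /= ltr_pdivlMr// => st.
    apply: le_lt_trans st; rewrite mulrDr mulr1 ler_wpDr// mulrC.
    have [le|/ltW le] := leP s t.
      by rewrite (le_trans (lip _ _ le))// (distrC s) [`|t - s|]ger0_norm ?subr_ge0.
    by rewrite distrC (le_trans (lip _ _ le))// [`|s - t|]ger0_norm ?subr_ge0.
  - have /andP[h1 _] := elliptic_idsym M eG d0.
    have /andP[h2 _] := elliptic_idsym (M + (- d) *: idsym) eG d0.
    rewrite -addrA -scalerDl addNr scale0r addr0 in h2.
    move: GM => /ler_normlP[g1 g2].
    by rewrite ge_min le_max; apply/andP; split; apply/orP; [left|right]; lra.
exists s => //; move: sd; rewrite in_itv/= ler_norml; exact.
Qed.

End Ellipticity.

(** * Viscosity solutions: reflection and rescaling *)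

Section ViscosityCalculus.
Variables (R : realType) (n : nat).
Implicit Types (u v phi : 'rV[R]_n -> R) (x y z b : 'rV[R]_n).
Implicit Types (A M N : symmx R n) (G : symmx R n -> R) (W U : set 'rV[R]_n).

Lemma viscosity_solutions_sub G W W' u : W' `<=` W ->
  viscosity_solutions G W u -> viscosity_solutions G W' u.
Proof.
move=> W'W [cu su Su]; split; first by move=> x /W'W; exact: cu.
- by move=> phi U x oU Ux UW'; apply: su => //; exact: subset_trans W'W.
- by move=> phi U x oU Ux UW'; apply: Su => //; exact: subset_trans W'W.
Qed.

(** A solution of class C^2 is its own test function. *)
Lemma viscosity_solutions_C2 G W u x : open W -> W x -> C2 W u ->
  viscosity_solutions G W u -> G (sym_part (hess u x)) = 0.
Proof.
move=> oW Wx cu [_ su Su]; apply/eqP; rewrite eq_le.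
by rewrite (su u W x)// (Su u W x).
Qed.

Lemma C2_continuous W u x : C2 W u -> W x -> {for x, continuous u}.
Proof.
move=> [du _] /du[d _]; exact: (@differentiable_continuous R _ R^o).
Qed.

Lemma oppE phi : (fun y => - phi y) = affq phi 0 1 (-1) 0 0 0.
Proof.
by apply/funext => y; rewrite /affq quad00 add0r scale1r addr0 mulN1r.
Qed.

Lemma shift01 W : [set y | W (0 + 1 *: y)] = W.
Proof. by apply/funext => y /=; rewrite add0r scale1r. Qed.

Lemma C2_opp U phi : open U -> C2 U phi -> C2 U (fun y => - phi y).
Proof.
move=> oU cphi.
by have := C2_affq 0 1 (-1) 0 0 (trmx0 _ _ _) oU cphi; rewrite shift01 oppE.
Qed.

Lemma hess_opp U phi x : open U -> C2 U phi -> U x ->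
  hess (fun y => - phi y) x = - hess phi x.
Proof.
move=> oU [dphi _] Ux; rewrite oppE (hess_affq _ _ _ (trmx0 _ _ _) oU dphi).
  by rewrite expr1n mulr1 add0r scale1r scaleN1r addr0.
by rewrite add0r scale1r.
Qed.

Lemma sym_partN (M : 'M[R]_n) : sym_part (- M) = - sym_part M.
Proof. by apply: val_inj; rewrite /= raddfN /= -opprD scalerN. Qed.

Lemma sym_partD (M N : 'M[R]_n) : sym_part (M + N) = sym_part M + sym_part N.
Proof. by apply: val_inj; rewrite /= [(M + N)^T]raddfD /= addrACA scalerDr. Qed.

Lemma sym_partZ (a : R) (M : 'M[R]_n) : sym_part (a *: M) = a *: sym_part M.
Proof. by apply: val_inj; rewrite /= linearZ /= -scalerDr !scalerA mulrC. Qed.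

(** The operator satisfied by the opposites of the solutions; it exchanges
    subsolutions and supersolutions. *)
Definition opp_op G : symmx R n -> R := fun M => - G (- M).

Lemma opp_opK G : opp_op (opp_op G) = G.
Proof. by apply/funext => M; rewrite /opp_op !opprK. Qed.

Lemma supersolution_opp G W u : viscosity_supersolution G W u ->
  viscosity_subsolution (opp_op G) W (fun y => - u y).
Proof.
move=> Su phi U x oU Ux UW cphi phix uphi.
have := Su (fun y => - phi y) U x oU Ux UW (C2_opp oU cphi).
rewrite phix opprK (hess_opp oU cphi Ux) sym_partN => /(_ erefl) h.
by rewrite /opp_op oppr_ge0; apply: h => y /uphi; rewrite lerNl.
Qed.

Lemma subsolution_opp G W u : viscosity_subsolution G W u ->
  viscosity_supersolution (opp_op G) W (fun y => - u y).
Proof.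
move=> Su phi U x oU Ux UW cphi phix uphi.
have := Su (fun y => - phi y) U x oU Ux UW (C2_opp oU cphi).
rewrite phix opprK (hess_opp oU cphi Ux) sym_partN => /(_ erefl) h.
by rewrite /opp_op oppr_le0; apply: h => y /uphi; rewrite lerNr.
Qed.

Lemma subsolution_opp_super G W u :
  viscosity_subsolution (opp_op G) W (fun y => - u y) ->
  viscosity_supersolution G W u.
Proof.
move=> /subsolution_opp; rewrite opp_opK.
by have -> : (fun y => - - u y) = u by apply/funext => y; rewrite opprK.
Qed.

Lemma uniform_ellipticity_opp lam Lam G :
  uniform_ellipticity lam Lam G -> uniform_ellipticity lam Lam (opp_op G).
Proof.
move=> eG M N N0; have := eG (- (M + N)) _ N0.
have -> : - (M + N) + N = - M by rewrite opprD subrK.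
by rewrite /opp_op opprK (addrC (- G _)).
Qed.

(** The inverse of [affq] on test functions: the polynomial is removed in the
    variable [y], where it has given coefficients, and then [y] is expressed by
    [x0 + rho *: y]. *)
Definition pullback phi x0 (rho c c0 : R) b (B : 'M[R]_n) :=
  affq (affq phi 0 1 1 (- c0) (- b) (- B)) (- rho^-1 *: x0) rho^-1 c^-1 0 0 0.

Section Change.
Variables (x0 b : 'rV[R]_n) (rho c c0 : R) (B : 'M[R]_n).
Hypotheses (rho0 : 0 < rho) (c_gt0 : 0 < c) (sB : B^T = B).

Lemma shiftK z : x0 + rho *: (- rho^-1 *: x0 + rho^-1 *: z) = z.
Proof.
have r0 : rho != 0 by rewrite gt_eqF.
rewrite scalerDr !scalerA mulrN mulfV// scaleN1r scale1r addrA subrr.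
by rewrite add0r.
Qed.

Lemma shiftVK y : - rho^-1 *: x0 + rho^-1 *: (x0 + rho *: y) = y.
Proof.
have r0 : rho != 0 by rewrite gt_eqF.
by rewrite scalerDr scalerA mulVf// scale1r addrA scaleNr addNr add0r.
Qed.

Lemma pullbackE phi y :
  pullback phi x0 rho c c0 b B (x0 + rho *: y) = c^-1 * (phi y - quad c0 b B y).
Proof.
rewrite /pullback {1}/affq quad00 addr0 shiftVK /affq add0r scale1r mul1r.
by rewrite /quad frobNr bformNl; congr (_ * _); ring.
Qed.

Definition image_shift U : set 'rV[R]_n :=
  [set z | U (- rho^-1 *: x0 + rho^-1 *: z)].

Lemma C2_pullback U phi : open U -> C2 U phi ->
  C2 (image_shift U) (pullback phi x0 rho c c0 b B).
Proof.
move=> oU cphi.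
have sNB : (- B)^T = - B by rewrite raddfN /= sB.
have := C2_affq 0 1 1 (- c0) (- b) sNB oU cphi; rewrite shift01 => cphi1.
exact: C2_affq (trmx0 _ _ _) oU cphi1.
Qed.

Lemma hess_pullback U phi y : open U -> C2 U phi -> U y ->
  hess (pullback phi x0 rho c c0 b B) (x0 + rho *: y) =
    (c * rho ^+ 2)^-1 *: (hess phi y - B).
Proof.
move=> oU cphi Uy.
have sNB : (- B)^T = - B by rewrite raddfN /= sB.
have := C2_affq 0 1 1 (- c0) (- b) sNB oU cphi; rewrite shift01 => -[d1 _].
rewrite /pullback (hess_affq _ _ _ (trmx0 _ _ _) oU d1) shiftVK//.
rewrite addr0 (hess_affq _ _ _ sNB oU cphi.1); rewrite add0r scale1r//.
by rewrite expr1n mulr1 scale1r invfM exprVn.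
Qed.

End Change.

(** The invariance behind the hypothesis on the family: if [A] is a zero of the
    operator, subtracting a quadratic polynomial with Hessian [A] and then
    scaling turns solutions for [G] into solutions for [rescale A t G]. It
    serves with [A = 0] for translations and dilations, and with the Hessian of
    an approximating polynomial in the iteration. *)
Lemma viscosity_solutions_affq G W u x0 (rho c c0 : R) b A :
  open W -> 0 < rho -> 0 < c -> G A = 0 -> C2 W u ->
  viscosity_solutions G W u ->
  viscosity_solutions (rescale A (c * rho ^+ 2) G) [set y | W (x0 + rho *: y)]
    (affq u x0 rho c c0 b (- (c * rho ^+ 2) *: (A : 'M[R]_n))).
Proof.
move=> oW rho0 c_gt0 GA cu [_ su Su].
set t := c * rho ^+ 2; set B := - t *: (A : 'M[R]_n).
have t0 : 0 < t by rewrite mulr_gt0 ?exprn_gt0.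
have sB : B^T = B by rewrite linearZ /= symmx_tr.
have r0 : rho != 0 by rewrite gt_eqF.
have hE phi U y : open U -> U y -> C2 U phi ->
    sym_part (hess (pullback phi x0 rho c c0 b B) (x0 + rho *: y)) =
    A + t^-1 *: sym_part (hess phi y).
  move=> oU Uy cphi; rewrite (hess_pullback _ _ _ _ rho0 sB oU cphi Uy).
  rewrite sym_partZ sym_partD sym_partN sym_partZ sym_part_symmx -/t.
  rewrite scaleNr opprK scalerDr scalerA mulVf ?scale1r; first by rewrite addrC.
  by rewrite gt_eqF.
have subU U : U `<=` [set y | W (x0 + rho *: y)] -> image_shift x0 rho U `<=` W.
  by move=> UW z /UW /=; rewrite shiftK.
have imU U y : U y -> image_shift x0 rho U (x0 + rho *: y).
  by rewrite /image_shift /= shiftVK.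
have val phi y : phi y = affq u x0 rho c c0 b B y ->
    pullback phi x0 rho c c0 b B (x0 + rho *: y) = u (x0 + rho *: y).
  by move=> h; rewrite pullbackE// h /affq addrK mulKf// gt_eqF.
split.
- by move=> y; apply: C2_continuous; exact: C2_affq.
- move=> phi U y oU Uy UW cphi phiy uphi.
  have h := su (pullback phi x0 rho c c0 b B) (image_shift x0 rho U) (x0 + rho *: y)
    (open_shift oU) (imU _ _ Uy) (subU _ UW) (C2_pullback _ _ _ _ _ sB oU cphi) (val _ _ phiy).
  rewrite (hE phi U y oU Uy cphi) in h.
  rewrite /rescale GA subr0; rewrite mulr_ge0 ?(ltW t0)//; apply: h.
  move=> z Uz; rewrite -(shiftK x0 rho0 z) pullbackE// ler_pdivlMl//.
  by rewrite lerBrDr; exact: uphi.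
- move=> phi U y oU Uy UW cphi phiy uphi.
  have h := Su (pullback phi x0 rho c c0 b B) (image_shift x0 rho U) (x0 + rho *: y)
    (open_shift oU) (imU _ _ Uy) (subU _ UW) (C2_pullback _ _ _ _ _ sB oU cphi) (val _ _ phiy).
  rewrite (hE phi U y oU Uy cphi) in h.
  rewrite /rescale GA subr0; rewrite pmulr_rle0//; apply: h.
  move=> z Uz; rewrite -(shiftK x0 rho0 z) pullbackE// ler_pdivrMl//.
  by rewrite lerBlDr; exact: uphi.
Qed.

End ViscosityCalculus.

(** * Interior Lipschitz estimate by doubling of variables *)

Section Lipschitz.
Variables (R : realType) (n : nat).
Implicit Types (u v phi : 'rV[R]_n -> R) (x y z e w : 'rV[R]_n).
Implicit Types (A M N : symmx R n) (G : symmx R n -> R) (W U : set 'rV[R]_n).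

(** First-order terms cancel in a symmetric difference, so that at a maximum the
    gradients need not be matched. *)
Lemma symmetric_difference W u x e (eps : R) : open W -> W x -> C2 W u -> 0 < eps ->
  exists2 d : R, 0 < d & forall t : R, 0 < t < d ->
  `|u (x + t *: e) + u (x - t *: e) - 2 * u x - t ^+ 2 * bform (hess u x) e e|
    <= eps * t ^+ 2.
Proof.
move=> oW Wx [du cu] eps0.
have /nbhs_eballP[d1 d10 Wd] : nbhs x W by exact: open_nbhs_nbhs.
have K0 : 0 < fnorm e ^+ 2 + 1 by rewrite ltr_wpDl ?sqr_ge0.
have [d2 d20 hd2] :=
  (continuous_mx_eballP (hess u) x).1 (cu x Wx) _ (divr_gt0 (divr_gt0 eps0 (ltr0n _ 2)) K0).
pose d := Num.min d1 d2; have d0 : 0 < d by rewrite lt_min d10.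
have e10 : 0 < fnorm e + 1 by rewrite ltr_wpDl ?fnorm_ge0.
exists (d / (fnorm e + 1)); first by rewrite divr_gt0.
have one (s t : R) : `|s| = t -> 0 < t < d / (fnorm e + 1) ->
    `|u (x + s *: e) - u x - frob (s *: e) (grad u x) -
      bform (hess u x) (s *: e) (s *: e) / 2| <= eps / 2 * t ^+ 2.
  move=> st /andP[t0]; rewrite ltr_pdivlMr// => td.
  have inb (r : R) : 0 <= r <= 1 -> eball x d (x + r *: (s *: e)).
    move=> /andP[r0 r1]; rewrite eballE addrAC subrr add0r !fnormZ ger0_norm// st.
    apply: le_lt_trans td; apply: (@le_trans _ _ (t * fnorm e)).
      by rewrite ler_piMl// mulr_ge0 ?fnorm_ge0 ?(ltW t0).
    by rewrite ler_wpM2l ?(ltW t0)// lerDl.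
  apply: taylor2 => r r01; have := inb r r01; rewrite eballE lt_min => /andP[rd1 rd2].
    by apply: du; exact: Wd.
  have h := hd2 _ rd2; rewrite -bformNl -bformDl.
  apply: (le_trans (ler_norm_bform _ _ _)).
  rewrite fnorm_distC in h; rewrite ltr_pdivlMr// in h.
  rewrite !fnormZ st mulrACA -!expr2 mulrCA [leRHS]mulrC ler_wpM2l ?sqr_ge0//.
  apply: le_trans (ltW h); rewrite ler_wpM2l ?fnorm_ge0//.
  by rewrite lerDl.
move=> t /[dup] /andP[t0 _] td.
have := one t t (gtr0_norm t0) td.
have := one (- t) t _ td; rewrite normrN gtr0_norm// => /(_ erefl).
rewrite !scaleNr frobNl bformNxl bformNxr opprK !bformZxl !bformZxr !frobZl.
move: (hess u) (grad u) => H g.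
set a := frob _ _; set b := bform _ _ _; clearbody a b.
move=> /ler_normlP[h1 h2] /ler_normlP[h3 h4].
by apply/ler_normlP; split; lra.
Qed.

(** The second-order condition at a maximum in two variables, tested along a
    single line at a time: this avoids differentiating [fnorm (x - y)], whose
    restriction to the lines that are used is affine or constant. *)
Lemma second_order_condition W u x y e w (c : R) : open W -> W x -> W y -> C2 W u ->
  (exists2 d : R, 0 < d & forall t : R, 0 < t < d ->
    u (x + t *: e) + u (x - t *: e) - 2 * u x -
    (u (y + t *: w) + u (y - t *: w) - 2 * u y) <= c * t ^+ 2) ->
  bform (hess u x) e e - bform (hess u y) w w <= c.
Proof.
move=> oW Wx Wy cu [d d0 hd]; apply/ler_addgt0Pr => eps eps0.
have eps2 : 0 < eps / 2 by rewrite divr_gt0.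
have [d1 d10 h1] := symmetric_difference e oW Wx cu eps2.
have [d2 d20 h2] := symmetric_difference w oW Wy cu eps2.
pose t := Num.min d (Num.min d1 d2) / 2.
have m0 : 0 < Num.min d (Num.min d1 d2) by rewrite !lt_min d0 d10.
have t0 : 0 < t by rewrite divr_gt0.
have : t < Num.min d (Num.min d1 d2) by rewrite /t; lra.
rewrite !lt_min => /and3P[td td1 td2].
have := hd t; have := h1 t; have := h2 t; rewrite t0 td td1 td2 /=.
move=> /(_ isT)/ler_normlP[g1 g2] /(_ isT)/ler_normlP[g3 g4] /(_ isT) g5.
have t20 : 0 < t ^+ 2 by rewrite exprn_gt0.
move: t20 g1 g2 g3 g4 g5; move: (hess u) => H; move: (t ^+ 2) => s.
move: (bform (H x) e e) (bform (H y) w w) => p q s0 g1 g2 g3 g4 g5.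
rewrite -subr_ge0 -(pmulr_rge0 _ s0); lra.
Qed.

Lemma fnorm_sqr_sym x w (t : R) :
  fnorm (x + t *: w) ^+ 2 + fnorm (x - t *: w) ^+ 2 - 2 * fnorm x ^+ 2 =
  2 * t ^+ 2 * fnorm w ^+ 2.
Proof.
rewrite !sqr_fnorm !(frobDl, frobDr, frobNl, frobNr, frobZl, frobZr) (frobC w x).
by ring.
Qed.

(** The doubling of variables is contradicted through this inequality: [X - Y] is
    [K] times the identity minus a positive semidefinite matrix, whose trace is
    at least [c] by its value at [e], and at most what ellipticity allows when
    [X] and [Y] are both zeros of [G]. *)
Lemma elliptic_doubling (lam Lam : R) G (X Y : 'M[R]_n) e (K c : R) :
  0 < lam -> uniform_ellipticity lam Lam G -> 0 <= K -> fnorm e = 1 ->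
  G (sym_part X) = 0 -> G (sym_part Y) = 0 ->
  (forall x, bform X x x - bform Y x x <= K * fnorm x ^+ 2) ->
  bform X e e - bform Y e e <= K - c ->
  lam * c <= Lam * (K * n%:R).
Proof.
move=> lam0 eG K0 e1 GX GY hK hc.
pose N := K *: idsym R n - (sym_part X - sym_part Y).
have NE x : bform N x x = K * fnorm x ^+ 2 - (bform X x x - bform Y x x).
  rewrite -[symmx_val N]/(symmx_val (K *: idsym R n) -
    (symmx_val (sym_part X) - symmx_val (sym_part Y))).
  rewrite !(bformDl, bformNl) bform_idsym /= !bformZl !bformDl !bform_tr.
  by field.
have N0 : psdmx N by apply/psdmxE => x; rewrite NE subr_ge0.
have Nc : c <= \tr (N : 'M[R]_n).
  apply: le_trans (psdmx_bform_le_tr N0 e1).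
  by rewrite NE e1 expr1n mulr1; lra.
have /andP[h1 _] := eG (sym_part X) _ N0.
have /andP[_ h2] := elliptic_idsym (sym_part Y) eG K0.
have E : sym_part X + N = sym_part Y + K *: idsym R n.
  by rewrite /N opprB addrCA (addrC (sym_part Y)) addNKr addrC.
rewrite E GX subr0 in h1; rewrite GY subr0 in h2.
apply: le_trans h2; apply: le_trans h1.
by rewrite ler_wpM2l// ltW.
Qed.

(** The function maximized in the doubling of variables, with [p.1 = x] and
    [p.1 + p.2 = y]. The modulus is quadratic in the distance [fnorm p.2]; its
    concavity, of size [L], is what the ellipticity inequality contradicts. The
    last term localizes near [x0]. *)
Definition doubled u x0 (L K d : R) (p : 'rV[R]_n * 'rV[R]_n) : R :=
  u p.1 - u (p.1 + p.2) - L * (2 * d * fnorm p.2 - fnorm p.2 ^+ 2)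
  - K * fnorm (p.1 - x0) ^+ 2.

Lemma continuous_doubled u x0 (L K d : R) p :
  {for p.1, continuous u} -> {for p.1 + p.2, continuous u} ->
  {for p, continuous (doubled u x0 L K d)}.
Proof.
move=> c1 c2.
have f1 : {for p, continuous (fun q : 'rV[R]_n * 'rV[R]_n => q.1)} by exact: cvg_fst.
have f2 : {for p, continuous (fun q : 'rV[R]_n * 'rV[R]_n => q.2)} by exact: cvg_snd.
have f3 : {for p, continuous (fun q : 'rV[R]_n * 'rV[R]_n => q.1 + q.2)}.
  exact: (continuousD f1 f2).
have g1 : {for p, continuous (fun q : 'rV[R]_n * 'rV[R]_n => u q.1)}.
  exact: (continuous_comp f1 c1).
have g2 : {for p, continuous (fun q : 'rV[R]_n * 'rV[R]_n => u (q.1 + q.2))}.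
  exact: (continuous_comp f3 c2).
have g3 : {for p, continuous (fun q : 'rV[R]_n * 'rV[R]_n => fnorm q.2)}.
  exact: (continuous_comp f2 (@continuous_fnorm R 1 n p.2)).
have f4 : {for p, continuous (fun q : 'rV[R]_n * 'rV[R]_n => q.1 - x0)}.
  exact: (continuous_comp f1 (@continuous_subr_cst R n x0 p.1)).
have g4 : {for p, continuous (fun q : 'rV[R]_n * 'rV[R]_n => fnorm (q.1 - x0))}.
  exact: (continuous_comp f4 (@continuous_fnorm R 1 n (p.1 - x0))).
apply: cvgB; last by apply: cvgMr; rewrite expr2; apply: cvgM.
apply: cvgB; first exact: cvgB.
apply: cvgMr; apply: cvgB; first exact: cvgMr.
by rewrite expr2; apply: cvgM.
Qed.

Section Doubling.
Variables (lam Lam L : R) (G : symmx R n -> R) (u : 'rV[R]_n -> R).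
Hypotheses (lam0 : 0 < lam) (L32 : 32 <= L).
Hypothesis (LLam : Lam * (64 * n%:R) < lam * (8 * L)).
Hypothesis (eG : uniform_ellipticity lam Lam G).
Hypothesis (cu : C2 (eball 0 1) u).
Hypothesis (Gu : forall x, eball 0 1 x -> G (sym_part (hess u x)) = 0).
Hypothesis (u1 : forall x, eball 0 1 x -> `|u x| <= 1).

Let Phi x0 := doubled u x0 L 32 (1 / 4).

(** At such a point the penalizations force [x] and [w] to be interior with
    [w != 0]. Moving both points by [xi] leaves their distance unchanged and
    bounds the difference of the Hessians by [2 * 32]; moving them oppositely
    along [e] uses the concavity of the modulus and gains [- 8 * L]. *)
Lemma doubled_interior_max x0 x w : eball 0 (1 / 2) x0 ->
  fnorm (x - x0) <= 1 / 4 -> fnorm w <= 1 / 4 -> 0 < Phi x0 (x, w) ->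
  (forall x' w', fnorm (x' - x0) <= 1 / 4 -> fnorm w' <= 1 / 4 ->
    Phi x0 (x', w') <= Phi x0 (x, w)) -> False.
Proof.
rewrite eballE subr0 => x01 xx0 w4 Ppos maxP.
have oB := @open_eball R n 0 1.
have nx : fnorm x < 3 / 4.
  by rewrite -[x](subrK x0) (le_lt_trans (ler_fnormD _ _))//; lra.
have Bx : eball 0 1 x by rewrite eballE subr0; lra.
have By : eball 0 1 (x + w).
  by rewrite eballE subr0 (le_lt_trans (ler_fnormD _ _))//; lra.
have [/ler_normlP[ux1 ux2] /ler_normlP[uy1 uy2]] := (u1 Bx, u1 By).
have r0 := fnorm_ge0 w; have s0 := fnorm_ge0 (x - x0).
have Ppos' := Ppos; rewrite /Phi /doubled /= in Ppos'.
have w0 : 0 < fnorm w.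
  rewrite lt_def r0 andbT; apply/eqP => /fnorm0_eq0 w0.
  by move: Ppos' (sqr_ge0 (fnorm (x - x0))); rewrite w0 addr0 fnorm0; lra.
have w14 : fnorm w < 1 / 4.
  rewrite lt_def w4 andbT; apply/eqP => wE.
  by move: Ppos' (sqr_ge0 (fnorm (x - x0))) L32; rewrite -wE; lra.
have x14 : fnorm (x - x0) < 1 / 4.
  rewrite lt_def xx0 andbT; apply/eqP => xE.
  have : 0 <= L * (2 * (1 / 4) * fnorm w - fnorm w ^+ 2).
    by rewrite mulr_ge0//; [move: L32; lra|nra].
  by move: Ppos' L32; rewrite -xE; lra.
pose e := (fnorm w)^-1 *: w.
have e1 : fnorm e = 1.
  by rewrite /e fnormZ ger0_norm ?invr_ge0// mulVf// gt_eqF.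
have we : w = fnorm w *: e by rewrite /e scalerA mulfV ?scale1r// gt_eqF.
have ne (s : R) : 0 <= s -> fnorm (s *: e) = s.
  by move=> s0'; rewrite fnormZ e1 mulr1 ger0_norm.
suff : lam * (8 * L) <= Lam * (64 * n%:R) by rewrite leNgt LLam.
apply: (elliptic_doubling lam0 eG _ e1 (Gu Bx) (Gu By)) => //.
  (* both points move by [xi] *)
  move=> xi.
  apply: (second_order_condition oB Bx By cu).
  have k0 : 0 < fnorm xi + 1 by rewrite ltr_wpDl ?fnorm_ge0.
  exists ((1 / 4 - fnorm (x - x0)) / (fnorm xi + 1)).
    by rewrite divr_gt0// subr_gt0.
  move=> t /andP[t0]; rewrite ltr_pdivlMr// => tk.
  have txi : fnorm (t *: xi) <= 1 / 4 - fnorm (x - x0).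
    by rewrite fnormZ gtr0_norm//; have := fnorm_ge0 xi; nra.
  have b1 : fnorm (x + t *: xi - x0) <= 1 / 4.
    by rewrite addrAC (le_trans (ler_fnormD _ _))//; lra.
  have b2 : fnorm (x - t *: xi - x0) <= 1 / 4.
    by rewrite addrAC (le_trans (ler_fnormB _ _))//; lra.
  have := maxP _ _ b1 w4; have := maxP _ _ b2 w4.
  rewrite /Phi /doubled /= !(addrAC x _ w) !(addrAC x _ (- x0)).
  by have := fnorm_sqr_sym (x - x0) xi t; nra.
(* opposite moves along [e]: the distance changes by [2 * t] exactly *)
apply: (second_order_condition oB Bx By cu).
pose m := Num.min (1 / 4 - fnorm (x - x0)) (Num.min ((1 / 4 - fnorm w) / 2) (fnorm w / 2)).
exists m; first by rewrite /m !lt_min; apply/and3P; split; lra.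
move=> t /andP[t0]; rewrite /m !lt_min => /and3P[t1 t2 t3].
have b1 : fnorm (x + t *: e - x0) <= 1 / 4.
  by rewrite addrAC (le_trans (ler_fnormD _ _))// ne; lra.
have b2 : fnorm (x - t *: e - x0) <= 1 / 4.
  by rewrite addrAC (le_trans (ler_fnormB _ _))// ne; lra.
have w1 : fnorm (w - (2 * t) *: e) = fnorm w - 2 * t.
  by rewrite {1}we -scalerBl ne//; lra.
have w2 : fnorm (w + (2 * t) *: e) = fnorm w + 2 * t.
  by rewrite {1}we -scalerDl ne//; lra.
have y1 : x + t *: e + (w - (2 * t) *: e) = x + w - t *: e.
  by rewrite addrACA -scalerBl (_ : t - 2 * t = - t) ?scaleNr//; ring.
have y2 : x - t *: e + (w + (2 * t) *: e) = x + w + t *: e.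
  by rewrite addrACA (addrC (- _)) -scalerBl (_ : 2 * t - t = t)//; ring.
have c1 : fnorm (w - (2 * t) *: e) <= 1 / 4 by rewrite w1; lra.
have c2 : fnorm (w + (2 * t) *: e) <= 1 / 4 by rewrite w2; lra.
have := maxP _ _ b1 c1; have := maxP _ _ b2 c2.
rewrite /Phi /doubled /= y1 y2 w1 w2 !(addrAC x _ (- x0)).
have := fnorm_sqr_sym (x - x0) e t; rewrite e1 expr1n.
nra.
Qed.

Lemma doubled_le0 x0 w : eball 0 (1 / 2) x0 -> fnorm w <= 1 / 4 ->
  u x0 - u (x0 + w) <= L * (1 / 2 * fnorm w - fnorm w ^+ 2).
Proof.
move=> Bx0 w4; rewrite leNgt; apply/negP => bad.
have P0 : 0 < Phi x0 (x0, w).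
  rewrite /Phi /doubled /= subrr fnorm0 expr0n mulr0 subr0.
  by move: bad; lra.
pose D := cball x0 (1 / 4) `*` cball (0 : 'rV[R]_n) (1 / 4).
have cD : compact D by apply: compact_setX; exact: compact_cball.
have D0 : D (x0, w) by split; rewrite /= cballE ?subrr ?fnorm0 ?subr0//; lra.
have ctsP : {within D, continuous (Phi x0)}.
  apply: continuous_in_subspaceT => -[x z] /[!inE] -[/= ]; rewrite !cballE subr0 => xD zD.
  move: Bx0; rewrite eballE subr0 => Bx0.
  have nx : fnorm x < 3 / 4.
    by rewrite -[x](subrK x0) (le_lt_trans (ler_fnormD _ _))//; lra.
  apply: continuous_doubled => /=; apply: (C2_continuous cu); rewrite eballE subr0.
    by lra.
  by rewrite (le_lt_trans (ler_fnormD _ _))//; lra.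
have [[x z] /[!inE] -[/=]] := compact_EVT_max (ex_intro _ _ D0) cD ctsP.
rewrite !cballE subr0 => xD zD maxP.
apply: (@doubled_interior_max x0 x z) => //.
  by apply: lt_le_trans P0 _; apply: maxP; rewrite inE.
by move=> x' w' x'D w'D; apply: maxP; rewrite inE; split => //=; rewrite cballE subr0.
Qed.

(** The modulus of [doubled_le0] is used at distances up to 1/4; beyond that the
    bound by 1 suffices. *)
Lemma interior_lipschitz x y : eball 0 (1 / 2) x -> eball 0 (1 / 2) y ->
  `|u x - u y| <= L * fnorm (x - y).
Proof.
suff one x' y' : eball 0 (1 / 2) x' -> eball 0 (1 / 2) y' ->
    u x' - u y' <= L * fnorm (x' - y').
  by move=> Bx By; apply/ler_normlP; split; [rewrite opprB fnorm_distC|]; exact: one.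
move=> Bx By; rewrite fnorm_distC.
have n0 := fnorm_ge0 (y' - x').
have [le4|/ltW ge4] := leP (fnorm (y' - x')) (1 / 4).
  have := doubled_le0 Bx le4; rewrite subrKC => /le_trans; apply.
  by move: L32; nra.
have B1 z : eball 0 (1 / 2) z -> eball (0 : 'rV[R]_n) 1 z.
  by rewrite !eballE subr0; lra.
have [/ler_normlP[h1 h2] /ler_normlP[h3 h4]] := (u1 (B1 _ Bx), u1 (B1 _ By)).
move: L32; nra.
Qed.

End Doubling.

End Lipschitz.

(** * Stability of viscosity subsolutions *)

Section Stability.
Variables (R : realType) (n : nat).
Implicit Types (u v phi : 'rV[R]_n -> R) (x y z e w : 'rV[R]_n).
Implicit Types (A M N : symmx R n) (G : symmx R n -> R) (W U : set 'rV[R]_n).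

(** The derivative in the direction of the gradient itself is its squared
    norm. *)
Lemma grad_le_lipschitz u x (L d : R) : differentiable (u : _ -> R^o) x ->
  0 <= L -> 0 < d ->
  (forall y, eball x d y -> `|u y - u x| <= L * fnorm (y - x)) ->
  fnorm (grad u x) <= L.
Proof.
move=> du L0 d0 hL; set g := grad u x.
have [->//|g0] := eqVneq (fnorm g) 0.
have gp : 0 < fnorm g by rewrite lt_def g0 fnorm_ge0.
rewrite -(ler_pM2r gp) -expr2 sqr_fnorm.
have du0 : differentiable (u : _ -> R^o) (x + 0 *: g) by rewrite scale0r addr0.
have D := is_derive_line du0; rewrite scale0r addr0 -/g in D.
rewrite -(@derive_val _ _ _ _ _ _ _ D).
apply: limr_le; first exact: (@ex_derive _ _ _ _ _ _ _ D).
near=> h.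
have h0 : h != 0 by near: h; exact: nbhs_dnbhs_neq.
have hd : `|h| * fnorm g < d.
  rewrite -ltr_pdivlMr//; near: h; apply: dnbhs0_lt.
  by rewrite divr_gt0.
rewrite -[X in X <= _]/(h^-1 * (u (x + (h * 1 + 0) *: g) - u (x + 0 *: g))).
rewrite mulr1 addr0 scale0r addr0.
have B : eball x d (x + h *: g) by rewrite eballE addrAC subrr add0r fnormZ.
have := hL _ B; rewrite addrAC subrr add0r fnormZ => H.
apply: le_trans (ler_norm _) _; rewrite normrM normfV ler_pdivrMl ?normr_gt0//.
by rewrite mulrCA.
Unshelve. all: by end_near. Qed.

Lemma fnorm_tr (B : 'M[R]_n) : fnorm B^T = fnorm B.
Proof.
rewrite !fnormE /frob exchange_big; congr Num.sqrt.
by apply: eq_bigr => i _; apply: eq_bigr => j _; rewrite !mxE.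
Qed.

Lemma fnorm_sym_part (B : 'M[R]_n) : fnorm (sym_part B) <= fnorm B.
Proof.
rewrite /= fnormZ ger0_norm ?invr_ge0//.
by have := ler_fnormD B B^T; rewrite fnorm_tr; lra.
Qed.

Lemma quad_sqr x y (c eps : R) :
  quad (eps * fnorm x ^+ 2 + c) (- (2 * eps) *: x) ((2 * eps) *: 1%:M) y =
  eps * fnorm (y - x) ^+ 2 + c.
Proof.
rewrite /quad bformZl bform1 !sqr_fnorm.
rewrite !(frobDl, frobDr, frobNl, frobNr, frobZl, frobZr) (frobC y x).
by field.
Qed.

(** The test function is made strict by adding [eps * fnorm (y - x) ^+ 2], and
    is then translated until it touches [u_ k] at a point close to [x]. Pointwise
    convergence of the operators suffices, because the Hessian at the contact
    point is compared with the one at [x] by monotonicity. *)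
Lemma subsolution_stable (I : Type) (FF : set_system I) (PF : ProperFilter FF)
    (lam Lam : R) W (G_ : I -> symmx R n -> R) (u_ : I -> 'rV[R]_n -> R) G u :
  0 < lam -> (forall k, uniform_ellipticity lam Lam (G_ k)) ->
  (forall M eps, 0 < eps -> \forall k \near FF, `|G_ k M - G M| <= eps) ->
  (forall K eps, compact K -> K `<=` W -> 0 < eps ->
    \forall k \near FF, forall y, K y -> `|u_ k y - u y| <= eps) ->
  (forall k x, W x -> {for x, continuous (u_ k)}) ->
  (forall k, viscosity_subsolution (G_ k) W (u_ k)) ->
  viscosity_subsolution G W u.
Proof.
move=> lam0 eG cG cu ctu su phi U x oU Ux UW cphi phix uphi.
have fin (a b c e q r eps eta : R) : 0 <= a -> a <= b -> b - c <= q -> q <= r ->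
    r + eps = eta -> c - e <= eps -> 0 <= e + eta by lra.
apply/ler_addgt0Pr => eta eta0.
pose K := `|Lam| * n%:R * 3 + 1.
have K0 : 0 < K by rewrite ltr_wpDl// !mulr_ge0.
pose eps := eta / K; have eps0 : 0 < eps by rewrite divr_gt0.
have /nbhs_eballP[d1 d10 Ud] : nbhs x U by exact: open_nbhs_nbhs.
have [d2 d20 hd2] := (continuous_mx_eballP (hess phi) x).1 (cphi.2 x Ux) _ eps0.
pose d := Num.min d1 d2 / 2.
have m0 : 0 < Num.min d1 d2 by rewrite lt_min d10.
have d0 : 0 < d by rewrite divr_gt0.
have dd1 : d < d1.
  by apply: (@lt_le_trans _ _ (Num.min d1 d2)); [rewrite /d; lra|rewrite ge_min lexx].
have dd2 : d < d2.
  by apply: (@lt_le_trans _ _ (Num.min d1 d2)); [rewrite /d; lra|rewrite ge_min lexx orbT].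
have KU : cball x d `<=` U.
  by move=> y; rewrite cballE => yd; apply: Ud; rewrite eballE (le_lt_trans yd).
have KW := subset_trans KU UW.
pose s := eps * d ^+ 2 / 3.
have s0 : 0 < s by rewrite divr_gt0// mulr_gt0// exprn_gt0.
have s3 : 3 * s = eps * d ^+ 2 by rewrite /s; field.
clearbody s.
near FF => k.
have uk : forall y, cball x d y -> `|u_ k y - u y| <= s.
  by near: k; exact: (cu _ _ (@compact_cball R n x d) KW s0).
have Gk : `|G_ k (sym_part (hess phi x)) - G (sym_part (hess phi x))| <= eps.
  by near: k; exact: cG.
pose psi (c : R) := affq phi 0 1 1 (eps * fnorm x ^+ 2 + c)
  (- (2 * eps) *: x) ((2 * eps) *: 1%:M).
have sI : ((2 * eps) *: 1%:M : 'M[R]_n)^T = (2 * eps) *: 1%:M.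
  by rewrite linearZ /= trmx1.
have psiE c y : psi c y = phi y + eps * fnorm (y - x) ^+ 2 + c.
  by rewrite /psi /affq quad_sqr add0r scale1r mul1r addrA.
have cpsi c : C2 U (psi c).
  have := C2_affq 0 1 1 (eps * fnorm x ^+ 2 + c) (- (2 * eps) *: x) sI oU cphi.
  by rewrite shift01.
have hpsi c y : U y -> hess (psi c) y = hess phi y + (2 * eps) *: 1%:M.
  move=> Uy; rewrite /psi (hess_affq _ _ _ sI oU cphi.1) ?add0r ?scale1r//.
  by rewrite expr1n mulr1 scale1r.
have Kx : cball x d x by rewrite cballE subrr fnorm0 ltW.
have ctd : {within cball x d, continuous (fun y => psi 0 y - u_ k y)}.
  apply: continuous_in_subspaceT => y /[!inE] yK.
  exact: (@continuousB _ R^o _ _ _ _ (C2_continuous (cpsi 0) (KU _ yK)) (ctu k y (KW _ yK))).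
have [xk /[!inE] Kxk mink] := compact_EVT_min (ex_intro _ x Kx) (@compact_cball R n x d) ctd.
have {}mink y : cball x d y -> psi 0 xk - u_ k xk <= psi 0 y - u_ k y.
  by move=> Ky; apply: mink; rewrite inE.
have Bxk : eball x d xk.
  have Kxk' : fnorm (xk - x) <= d := Kxk.
  rewrite eballE lt_def Kxk' andbT.
  apply/eqP => xkd.
  have := mink _ Kx; rewrite !psiE !addr0 -xkd subrr fnorm0 expr0n mulr0 addr0.
  have := uphi _ (KU _ Kxk).
  have /ler_normlP[h1 h2] := uk _ Kx; have /ler_normlP[h3 h4] := uk _ Kxk.
  by rewrite phix -s3; move: h1 h2 h3 h4; lra.
pose m := u_ k xk - psi 0 xk.
have h := su k (psi m) (eball x d) xk (@open_eball R n x d) Bxk.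
have BU : eball x d `<=` U.
  by move=> y; rewrite eballE => /ltW; exact: KU.
have h1 : 0 <= G_ k (sym_part (hess (psi m) xk)).
  apply: h; first exact: subset_trans BU UW.
  - split; first by move=> y /BU; exact: (cpsi m).1.
    by move=> y /BU; exact: (cpsi m).2.
  - by rewrite psiE /m psiE; ring.
  - move=> y; rewrite eballE => /ltW yd; have := mink _ yd.
    by rewrite /m !psiE; lra.
rewrite (hpsi _ _ (KU _ Kxk)) in h1.
have h2 : fnorm (hess phi xk - hess phi x) <= eps.
  have := hd2 xk (lt_trans Bxk dd2); move: (hess phi) => H h2.
  by rewrite fnorm_distC ltW.
have E : sym_part (hess phi xk + (2 * eps) *: 1%:M) =
    sym_part (hess phi xk) + (2 * eps) *: idsym R n.
  by rewrite sym_partD sym_partZ.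
rewrite E in h1.
have aux (a b i : symmx R n) :
    a + (3 * eps) *: i - (b + (2 * eps) *: i) = eps *: i - (b - a).
  rewrite !opprD opprK addrACA -scalerBl addrC (addrC a).
  by congr (_ *: _ + _); ring.
have P : psdmx (sym_part (hess phi x) + (3 * eps) *: idsym R n -
    (sym_part (hess phi xk) + (2 * eps) *: idsym R n) : symmx R n).
  have -> : sym_part (hess phi x) + (3 * eps) *: idsym R n -
    (sym_part (hess phi xk) + (2 * eps) *: idsym R n) =
    eps *: idsym R n - sym_part (hess phi xk - hess phi x).
    by rewrite sym_partD sym_partN; exact: aux.
  by apply: psd_idsymB; apply: (le_trans (fnorm_sym_part _)).
have h3 := elliptic_le lam0 (eG k) P.
have h4 : 0 <= 3 * eps by rewrite mulr_ge0// ltW.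
have /andP[_ h5] := elliptic_idsym (sym_part (hess phi x)) (eG k) h4.
move/ler_normlP: Gk => [g1 g2].
have h6 : Lam * (3 * eps * n%:R) <= `|Lam| * n%:R * 3 * eps.
  rewrite (_ : _ * _ * 3 * eps = `|Lam| * (3 * eps * n%:R)); last by ring.
  by rewrite ler_wpM2r ?ler_norm// mulr_ge0.
have h7 : `|Lam| * n%:R * 3 * eps + eps = eta.
  by rewrite /eps -[X in _ + X]mul1r -mulrDl -/K mulrC divfK// gt_eqF.
exact: fin eps eta h1 h3 h5 h6 h7 g2.
Unshelve. all: by end_near. Qed.

End Stability.

(** * Limits along ultrafilters *)

Section UltraLimits.

(** Ultrafilters replace extraction of subsequences: the limits of the operators
    and of the values of the solutions at all points exist along the same
    ultrafilter, whether or not the spaces are sequentially compact. *)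
Lemma ultra_compact_cvg (I : Type) (T : topologicalType) (UF : set_system I)
    (f : I -> T) (K : set T) : UltraFilter UF -> compact K ->
  (forall i, K (f i)) -> exists2 x, K x & f @ UF --> x.
Proof.
move=> UU cK fK.
have [x [Kx clx]] := cK (f @ UF) _ (filterS (fun i _ => fK i) filterT).
exists x => // V Vx; rewrite /= nbhs_filterE.
have [//|nV] := in_ultra_setVsetC (f @^-1` V) UU.
by have [y [/= nVy Vy]] := clx (~` V) V nV Vx.
Qed.

End UltraLimits.

Section Limits.
Variables (R : realType) (n : nat).
Implicit Types (u v phi : 'rV[R]_n -> R) (x y z e w : 'rV[R]_n).
Implicit Types (A M N : symmx R n) (G : symmx R n -> R) (W U : set 'rV[R]_n).

Lemma ultra_limit_operator (UF : set_system nat) (F : set (symmx R n -> R))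
    (G_ : nat -> symmx R n -> R) : UltraFilter UF ->
  compact (F : set {family compact, symmx R n -> R}) -> (forall k, F (G_ k)) ->
  exists2 G, F G & forall M eps, 0 < eps ->
    \forall k \near UF, `|G_ k M - G M| <= eps.
Proof.
move=> UU cF FG.
have [G FG' cG] := @ultra_compact_cvg _ {family compact, symmx R n -> R} _ G_ _ UU cF FG.
exists G => // M eps eps0.
have PF : ProperFilter (G_ @ UF) by apply: fmap_proper_filter.
have /fam_cvgP/(_ [set M] (@compact_set1 _ M)) := cG.
rewrite uniform_set1 => cGM.
have h : \forall k \near UF, `|G M - G_ k M| <= eps.
  exact: (@cvgr_dist_le R R^o _ _ _ _ _ cGM _ eps0).
by apply: filterS h => k; rewrite /= distrC.
Qed.

Lemma ultra_limit_pointwise (UF : set_system nat) W (u_ : nat -> 'rV[R]_n -> R) :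
  UltraFilter UF -> (forall k x, W x -> `|u_ k x| <= 1) ->
  exists u, forall x, W x -> forall eps, 0 < eps ->
    \forall k \near UF, `|u_ k x - u x| <= eps.
Proof.
move=> UU u1.
suff /choice[u hu] : forall x, exists l, W x -> forall eps, 0 < eps ->
    \forall k \near UF, `|u_ k x - l| <= eps by exists u.
move=> x; have [Wx|nWx] := pselect (W x); last by exists 0.
have uK k : `[-1, 1]%classic (u_ k x : R) by rewrite /= in_itv/= -ler_norml u1.
have [l _ cl] := ultra_compact_cvg UU (@segment_compact R (-1) 1) uK.
exists l => _ eps eps0.
have h : \forall k \near UF, `|l - u_ k x| <= eps.
  exact: (@cvgr_dist_le R R^o _ _ _ _ _ cl _ eps0).
by apply: filterS h => k; rewrite /= distrC.
Qed.

Lemma equilipschitz_limit (UF : set_system nat) W (u_ : nat -> 'rV[R]_n -> R) u (L : R) :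
  ProperFilter UF ->
  (forall k x y, W x -> W y -> `|u_ k x - u_ k y| <= L * fnorm (x - y)) ->
  (forall x, W x -> forall eps, 0 < eps ->
    \forall k \near UF, `|u_ k x - u x| <= eps) ->
  forall x y, W x -> W y -> `|u x - u y| <= L * fnorm (x - y).
Proof.
move=> PF lip cu x y Wx Wy; apply/ler_addgt0Pr => eps eps0.
have e2 : 0 < eps / 2 by rewrite divr_gt0.
near UF => k.
have /ler_normlP[h1 h2] : `|u_ k x - u x| <= eps / 2 by near: k; exact: cu.
have /ler_normlP[h3 h4] : `|u_ k y - u y| <= eps / 2 by near: k; exact: cu.
have /ler_normlP[h5 h6] := lip k x y Wx Wy.
by apply/ler_normlP; split; lra.
Unshelve. all: by end_near. Qed.

(** Pointwise limits suffice: the common Lipschitz constant carries the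
    convergence at a point to a neighbourhood, and compactness concludes. *)
Lemma equilipschitz_uniform (UF : set_system nat) W (u_ : nat -> 'rV[R]_n -> R) u (L : R) :
  ProperFilter UF -> open W -> 0 < L ->
  (forall k x y, W x -> W y -> `|u_ k x - u_ k y| <= L * fnorm (x - y)) ->
  (forall x, W x -> forall eps, 0 < eps ->
    \forall k \near UF, `|u_ k x - u x| <= eps) ->
  forall K eps, compact K -> K `<=` W -> 0 < eps ->
    \forall k \near UF, forall y, K y -> `|u_ k y - u y| <= eps.
Proof.
move=> PF oW L0 lip cu K eps cK KW eps0.
move/compact_near_coveringP : cK; apply => x Kx.
have e3 : 0 < eps / 3 by rewrite divr_gt0.
have e3L : 0 < eps / 3 / L by rewrite divr_gt0.
have Wx := KW _ Kx; have nW : nbhs x W by exact: open_nbhs_nbhs.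
near=> y k.
have Wy : W y by near: y; exact: nW.
have /ler_normlP[h1 h2] : `|u_ k x - u x| <= eps / 3 by near: k; exact: cu.
have yx : fnorm (y - x) < eps / 3 / L by near: y; exact: near_fnorm.
have Lyx : L * fnorm (y - x) <= eps / 3.
  by move: yx; rewrite ltr_pdivlMr// mulrC => /ltW.
have /ler_normlP[h3 h4] := le_trans (lip k y x Wy Wx) Lyx.
have /ler_normlP[h5 h6] := le_trans (equilipschitz_limit PF lip cu Wy Wx) Lyx.
by apply/ler_normlP; split; lra.
Unshelve. all: by end_near. Qed.

Lemma holder_seminorm_bound p q (a : R) (E : set 'rV[R]_n) (g : 'rV[R]_n -> 'M[R]_(p, q)) :
  (holder_seminorm a E g < +oo)%E ->
  exists2 H : R, 0 <= H & forall y z, E y -> E z ->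
    fnorm (g y - g z) <= H * fnorm (y - z) `^ a.
Proof.
move=> fin; exists (Num.max 0 (fine (holder_seminorm a E g))).
  by rewrite le_max lexx.
move=> y z Ey Ez; have [->|yz] := eqVneq y z.
  by rewrite subrr fnorm0 mulr_ge0 ?powR_ge0// le_max lexx.
have nyz : 0 < fnorm (y - z).
  rewrite lt_def fnorm_ge0 andbT; apply/eqP => /fnorm0_eq0/eqP.
  by rewrite subr_eq0 (negbTE yz).
rewrite -ler_pdivrMr ?powR_gt0// le_max; apply/orP; right.
have le1 : ((fnorm (g y - g z) / fnorm (y - z) `^ a)%:E <= holder_seminorm a E g)%E.
  by apply: ereal_sup_ubound; exists (y, z).
rewrite -lee_fin fineK// fin_numE; apply/andP; split.
  by apply/eqP => E0; rewrite E0 in le1.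
by apply/eqP => E0; rewrite E0 in fin.
Qed.

Lemma taylor_holder u y (H a r : R) : C2 (eball 0 r) u -> eball 0 r y ->
  0 <= H -> 0 <= a ->
  (forall z, eball 0 r z -> fnorm (hess u z - hess u 0) <= H * fnorm z `^ a) ->
  `|u y - quad (u 0) (grad u 0) (hess u 0) y| <= H * fnorm y `^ a * fnorm y ^+ 2.
Proof.
move=> [du _] By H0 a0 hH.
have inb (t : R) : 0 <= t <= 1 -> eball 0 r (0 + t *: y) /\ fnorm (0 + t *: y) <= fnorm y.
  move=> /andP[t0 t1]; rewrite eballE subr0 add0r fnormZ ger0_norm//.
  have := By; rewrite eballE subr0 => yr.
  have h : t * fnorm y <= fnorm y by rewrite ler_piMl ?fnorm_ge0.
  by split=> //; exact: le_lt_trans yr.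
have -> : u y - quad (u 0) (grad u 0) (hess u 0) y =
    u (0 + y) - u 0 - frob y (grad u 0) - bform (hess u 0) y y / 2.
  by rewrite add0r /quad !opprD !addrA.
apply: taylor2 => t t01; have [B1 B2] := inb t t01; first exact: du.
have h := hH _ B1; move: (hess u) h => Hu h.
rewrite -bformNl -bformDl (le_trans (ler_norm_bform _ _ _))// -expr2.
apply: ler_wpM2r; first exact: sqr_ge0.
apply: (le_trans h); apply: ler_wpM2l; first exact: H0.
by rewrite ge0_ler_powR ?nnegrE ?fnorm_ge0.
Qed.

End Limits.

(** * Improvement of flatness and its iteration *)

Section Family.
Variables (R : realType) (n : nat) (lam Lam : R) (F : set (symmx R n -> R)) (a b : R).
Hypotheses (n0 : (0 < n)%N) (lam0 : 0 < lam).
Hypothesis Fell : forall G, F G -> uniform_ellipticity lam Lam G.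
Hypothesis F0 : forall G, F G -> G 0 = 0.
Hypothesis Fcompact : compact (F : set {family compact, symmx R n -> R}).
Hypothesis Frescale : forall G A t, F G -> G A = 0 -> 0 < t -> F (rescale A t G).
Hypothesis Freg : forall G x0 (r : R), F G -> 0 < r ->
  viscosity_solutions G (eball x0 r) `<=` C2alpha_loc a (eball x0 r).
Hypotheses (b0 : 0 < b) (ba : b < a).
Implicit Types (u v phi : 'rV[R]_n -> R) (x y z e w : 'rV[R]_n).
Implicit Types (A M N : symmx R n) (G : symmx R n -> R) (W U : set 'rV[R]_n).

Definition normalized G u := [/\ F G, viscosity_solutions G (eball 0 1) u &
  forall x, eball 0 1 x -> `|u x| <= 1].

Lemma family_C2 G x0 (r : R) u : F G -> 0 < r ->
  viscosity_solutions G (eball x0 r) u -> C2 (eball x0 r) u.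
Proof. by move=> FG r0 /(Freg FG r0)[]. Qed.

Lemma normalized_C2 G u : normalized G u -> C2 (eball 0 1) u.
Proof. by move=> [FG su _]; exact: family_C2 su. Qed.

Lemma normalized_eq G u x : normalized G u -> eball 0 1 x ->
  G (sym_part (hess u x)) = 0.
Proof.
move=> Nu Bx; have [_ su _] := Nu.
exact: (viscosity_solutions_C2 (@open_eball R n 0 1) Bx (normalized_C2 Nu) su).
Qed.

(** A value of [L] that [interior_lipschitz] admits: it is at least 32, and
    [lam * (8 * L)] exceeds [Lam * (64 * n%:R)]. *)
Definition lip_cst : R := 33 + 8 * (`|Lam| * n%:R) / lam.

Lemma lip_cst_ge : 33 <= lip_cst.
Proof. by rewrite lerDl divr_ge0// ?mulr_ge0// ltW. Qed.

Lemma normalized_lipschitz G u x y : normalized G u ->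
  eball 0 (1 / 2) x -> eball 0 (1 / 2) y ->
  `|u x - u y| <= lip_cst * fnorm (x - y).
Proof.
move=> Nu; have [FG _ u1] := Nu.
apply: (interior_lipschitz lam0 _ _ (Fell FG) (normalized_C2 Nu) _ u1).
- by have := lip_cst_ge; lra.
- have -> : lam * (8 * lip_cst) = 264 * lam + `|Lam| * (64 * n%:R).
    by rewrite /lip_cst; field; rewrite gt_eqF.
  have h : Lam * (64 * n%:R) <= `|Lam| * (64 * n%:R).
    by rewrite ler_wpM2r ?ler_norm.
  by have l0 := lam0; lra.
- by move=> z; exact: normalized_eq.
Qed.

(** Compactness of the normalized solutions. The limit is a solution on the half
    ball, where the Lipschitz bound holds. *)
Lemma limit_solution (UF : set_system nat) (G_ : nat -> symmx R n -> R)
    (u_ : nat -> 'rV[R]_n -> R) : UltraFilter UF ->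
  (forall k, normalized (G_ k) (u_ k)) ->
  exists G u, [/\ F G, viscosity_solutions G (eball 0 (1 / 2)) u,
    (forall M eps, 0 < eps -> \forall k \near UF, `|G_ k M - G M| <= eps) &
    (forall K eps, compact K -> K `<=` eball 0 (1 / 2) -> 0 < eps ->
      \forall k \near UF, forall y, K y -> `|u_ k y - u y| <= eps)].
Proof.
move=> UU Nk.
have FG k : F (G_ k) by have [] := Nk k.
have sub12 : eball (0 : 'rV[R]_n) (1 / 2) `<=` eball 0 1.
  by move=> x; rewrite !eballE => /lt_trans; apply; lra.
have [G FG' cG] := ultra_limit_operator UU Fcompact FG.
have [u cu] : exists u, forall x, eball 0 (1 / 2) x -> forall eps, 0 < eps ->
    \forall k \near UF, `|u_ k x - u x| <= eps.
  by apply: ultra_limit_pointwise => k x /sub12; have [_ _] := Nk k; apply.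
have L0 : 0 < lip_cst by apply: lt_le_trans lip_cst_ge.
have lip k x y := @normalized_lipschitz (G_ k) (u_ k) x y (Nk k).
have oB := @open_eball R n 0 (1 / 2).
have PF : ProperFilter UF by exact: ultra_proper.
have unif := equilipschitz_uniform PF oB L0 lip cu.
have ulip := equilipschitz_limit PF lip cu.
have ctu v : (forall x y, eball 0 (1 / 2) x -> eball 0 (1 / 2) y ->
    `|v x - v y| <= lip_cst * fnorm (x - y)) ->
    forall x, eball 0 (1 / 2) x -> {for x, continuous v}.
  move=> lv x Bx; apply/continuous_eballP => eps eps0.
  have /nbhs_eballP[d d0 hd] : nbhs x (eball 0 (1 / 2)) by exact: open_nbhs_nbhs.
  exists (Num.min d (eps / lip_cst)); first by rewrite lt_min d0 divr_gt0.
  move=> y; rewrite eballE lt_min => /andP[yd ye].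
  rewrite (le_lt_trans (lv _ _ Bx (hd _ yd)))//.
  by move: ye; rewrite ltr_pdivlMr// fnorm_distC mulrC.
exists G, u; split => //.
  split; first exact: ctu ulip.
  - apply: (subsolution_stable PF lam0 (fun k => Fell (FG k)) cG unif).
      by move=> k x Bx; apply: ctu Bx => y z; exact: lip.
    by move=> k; have [_ [_ su _] _] := Nk k;
       move=> phi U x oU Ux UW; apply: su => //; exact: subset_trans sub12.
  - apply: subsolution_opp_super.
    apply: (@subsolution_stable R n _ UF PF lam Lam _ (fun k => opp_op (G_ k))
      (fun k y => - u_ k y) (opp_op G) (fun y => - u y)) => //.
    + by move=> k; apply: uniform_ellipticity_opp; exact: Fell.
    + move=> M eps eps0; apply: filterS (cG (- M) eps eps0) => k.
      have -> : opp_op (G_ k) M - opp_op G M = - (G_ k (- M) - G (- M)).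
        by rewrite /opp_op; ring.
      by rewrite normrN.
    + move=> K eps cK KB eps0; apply: filterS (unif K eps cK KB eps0) => k h y Ky.
      have -> : - u_ k y - - u y = - (u_ k y - u y) by ring.
      by rewrite normrN; exact: h.
    + move=> k x Bx; apply: (ctu (fun y => - u_ k y)) Bx => y z By Bz.
      have -> : - u_ k y - - u_ k z = - (u_ k y - u_ k z) by ring.
      by rewrite normrN; exact: lip.
    + move=> k; have [_ [_ _ Su] _] := Nk k.
      apply: supersolution_opp => phi U x oU Ux UW.
      by apply: Su => //; exact: subset_trans sub12.
Qed.

(** The exponent is lost here: the unknown Hoelder constant of the Hessian is
    absorbed by [rho `^ (a - b)] at a small scale [rho]. *)
Lemma taylor_at_scale G u (r0 : R) : 0 < r0 -> F G ->
  viscosity_solutions G (eball 0 r0) u ->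
  exists rho : R, [/\ 0 < rho, rho <= 1 / 4, rho < r0 &
    forall y, cball 0 rho y ->
      `|u y - quad (u 0) (grad u 0) (hess u 0) y| <= rho `^ b * rho ^+ 2 / 3].
Proof.
move=> r00 FG su; have cu := family_C2 FG r00 su.
have [_ holdu] := Freg FG r00 su.
pose r1 := r0 / 2; have r10 : 0 < r1 by rewrite divr_gt0.
have Kr : cball (0 : 'rV[R]_n) r1 `<=` eball 0 r0.
  by move=> y; rewrite cballE eballE /r1; move: r00; lra.
have [H H0 hH] := holder_seminorm_bound (holdu _ (@compact_cball R n 0 r1) Kr).
have ab0 : 0 < a - b by rewrite subr_gt0.
pose c := (3 * (H + 1))^-1; have c0 : 0 < c by rewrite invr_gt0 mulr_gt0// ltr_wpDl.
pose rho := Num.min (1 / 4) (Num.min (r1 / 2) (c `^ (a - b)^-1)).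
have rho0 : 0 < rho by rewrite !lt_min powR_gt0// !divr_gt0.
have [rho14 rho1 rhoc] : [/\ rho <= 1 / 4, rho <= r1 / 2 & rho <= c `^ (a - b)^-1].
  by rewrite !ge_min !lexx !orbT.
exists rho; split=> //; first by move: rho1; rewrite /r1; move: r00; lra.
move=> y; rewrite cballE subr0 => yrho.
have Cr1 : C2 (eball 0 r1) u.
  have sub : eball (0 : 'rV[R]_n) r1 `<=` eball 0 r0.
    by move=> z; rewrite eballE => /ltW; exact: Kr.
  by split=> [z /sub|z /sub]; [exact: cu.1|exact: cu.2].
have By : eball 0 r1 y by rewrite eballE subr0; move: r10; lra.
have a0 : 0 <= a by rewrite (le_trans (ltW b0))// ltW.
have T := taylor_holder Cr1 By H0 a0.
have {}T : `|u y - quad (u 0) (grad u 0) (hess u 0) y| <= H * fnorm y `^ a * fnorm y ^+ 2.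
  apply: T => z; rewrite eballE subr0 => zr.
  have := hH z 0; rewrite !cballE !subr0 fnorm0; apply; first exact: ltW.
  exact: ltW.
apply: (le_trans T).
have y0 := fnorm_ge0 y.
have h1 : H * fnorm y `^ a <= rho `^ b / 3.
  apply: (@le_trans _ _ (H * rho `^ a)).
    by rewrite ler_wpM2l// ge0_ler_powR ?nnegrE// ltW.
  have -> : a = b + (a - b) by rewrite addrC subrK.
  rewrite powRD; last by apply/implyP => _; rewrite gt_eqF.
  have h2 : rho `^ (a - b) <= c.
    apply: (@le_trans _ _ ((c `^ (a - b)^-1) `^ (a - b))).
      by rewrite ge0_ler_powR ?nnegrE ?powR_ge0// ltW.
    by rewrite -powRrM mulVf ?powRr1 ?(ltW c0)// gt_eqF.
  rewrite mulrCA ler_wpM2l ?powR_ge0//.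
  apply: (@le_trans _ _ (H * c)); first by rewrite ler_wpM2l.
  rewrite /c invfM mulrCA ger_pMr ?invr_gt0//.
  by rewrite ler_pdivrMr ?ltr_wpDl// mul1r lerDl.
rewrite (_ : rho `^ b * rho ^+ 2 / 3 = rho `^ b / 3 * rho ^+ 2); last by ring.
rewrite ler_pM ?mulr_ge0 ?powR_ge0 ?sqr_ge0//.
by rewrite lerXn2r ?nnegrE// ltW.
Qed.

(** Improvement of flatness. By compactness the scales at which solutions are
    close to a quadratic polynomial are bounded below: otherwise a limit of
    counterexamples would be a solution, hence close to its own Taylor
    polynomial at some scale, and this polynomial can be corrected by a small
    multiple of [fnorm x ^+ 2] into a solution of the nearby equations. *)
Lemma improvement : exists2 rho0 : R, 0 < rho0 &
  forall G u, normalized G u ->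
  exists rho c0 w A, [/\ rho0 <= rho <= 1 / 4, G A = 0 &
    forall x, eball 0 rho x -> `|u x - quad c0 w A x| <= rho `^ b * rho ^+ 2].
Proof.
apply: contrapT => nex.
have : forall k : nat, exists p : (symmx R n -> R) * ('rV[R]_n -> R),
    normalized p.1 p.2 /\ forall rho c0 w A, k.+1%:R^-1 <= rho <= 1 / 4 ->
    p.1 A = 0 -> ~ forall x, eball 0 rho x ->
      `|p.2 x - quad c0 w A x| <= rho `^ b * rho ^+ 2.
  move=> k; apply: contrapT => nk; apply: nex; exists k.+1%:R^-1; first by rewrite invr_gt0.
  move=> G u Nu; apply: contrapT => nr; apply: nk; exists (G, u); split => //=.
  by move=> rho c0 w A r01 GA h; apply: nr; exists rho, c0, w, A.
move=> /choice[p hp].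
pose G_ k := (p k).1; pose u_ k := (p k).2.
have Nk k : normalized (G_ k) (u_ k) by have [] := hp k.
have fin (v1 v2 v3 v4 t : R) : v1 - v2 <= t / 3 -> - (v1 - v2) <= t / 3 ->
  v2 - v3 <= t / 3 -> - (v2 - v3) <= t / 3 -> v4 <= t / 3 -> - v4 <= t / 3 ->
  `|v1 - (v3 + v4)| <= t by move=> *; apply/ler_normlP; split; lra.
have [UF [UU sUF]] := @ultraFilterLemma nat \oo _.
have PF : ProperFilter UF by exact: ultra_proper.
have [G [u [FG su cG cu]]] := limit_solution UU Nk.
have r00 : 0 < 1 / 2 :> R by rewrite divr_gt0.
have [rho [rho0 rho4 rho2 hrho]] := taylor_at_scale r00 FG su.
have C2u := family_C2 FG r00 su.
have oB := @open_eball R n 0 (1 / 2).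
have B0 : eball (0 : 'rV[R]_n) (1 / 2) 0 by exact: eball_center.
pose A := sym_part (hess u 0).
have GA : G A = 0 by exact: (viscosity_solutions_C2 oB B0 C2u su).
have AE : A = hess u 0 :> 'M[R]_n.
  by apply: sym_part_id; exact: (hess_sym oB B0 C2u).
rewrite -AE in hrho.
have p0 : 0 < rho `^ b by rewrite powR_gt0.
(* a multiple [s] of the identity with [`|s| <= d] changes the polynomial by at
   most a third of the allowed error on the ball of radius [rho] *)
pose d := rho `^ b / 3; have d0 : 0 < d by rewrite divr_gt0.
have nR : 0 < n%:R :> R by rewrite ltr0n.
have ld0 : 0 < lam * (d * n%:R) by rewrite !mulr_gt0.
have rb0 : 0 < rho `^ b * rho ^+ 2 / 3 by rewrite divr_gt0// mulr_gt0// exprn_gt0.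
have Kb : cball (0 : 'rV[R]_n) rho `<=` eball 0 (1 / 2).
  by move=> y; rewrite cballE eballE => /le_lt_trans; apply.
near UF => k.
have uk : forall y, cball 0 rho y -> `|u_ k y - u y| <= rho `^ b * rho ^+ 2 / 3.
  by near: k; apply: cu => //; exact: compact_cball.
have Gk : `|G_ k A| <= lam * (d * n%:R).
  by rewrite -[G_ k A]subr0 -GA; near: k; exact: cG.
have kr : k.+1%:R^-1 <= rho.
  by near: k; apply: sUF; apply: filterS (near_infty_natSinv_lt (PosNum rho0)) => k /ltW.
have [FGk _ _] := Nk k.
have [s sd Gs] := elliptic_zero n0 lam0 (Fell FGk) (ltW d0) Gk.
have [_ /(_ rho (u 0) (grad u 0) (A + s *: idsym R n))] := hp k.
rewrite kr rho4 => /(_ isT Gs); apply => y By.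
have Ky : cball 0 rho y by rewrite cballE ltW.
have /ler_normlP[h1 h2] := uk y Ky; have /ler_normlP[h3 h4] := hrho y Ky.
have -> : quad (u 0) (grad u 0) (A + s *: idsym R n : symmx R n) y =
    quad (u 0) (grad u 0) A y + s * fnorm y ^+ 2 / 2.
  rewrite /quad -[symmx_val (A + _)]/(symmx_val A + symmx_val (s *: idsym R n)).
  by rewrite bformDl bform_idsym mulrDl !addrA.
have /ler_normlP[h5 h6] : `|s * fnorm y ^+ 2 / 2| <= rho `^ b * rho ^+ 2 / 3.
  rewrite normrM [`|2^-1|]ger0_norm// normrM [`|fnorm y ^+ 2|]ger0_norm ?sqr_ge0//.
  rewrite (_ : rho `^ b * rho ^+ 2 / 3 = d * rho ^+ 2); last by rewrite /d; ring.
  apply: (@le_trans _ _ (`|s| * fnorm y ^+ 2)).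
    by rewrite ler_pdivrMr// ler_peMr ?ler1n// mulr_ge0 ?sqr_ge0.
  rewrite ler_pM ?sqr_ge0// lerXn2r ?nnegrE ?fnorm_ge0 ?(ltW rho0)//.
  by rewrite cballE subr0 in Ky.
exact: fin h2 h1 h4 h3 h6 h5.
Unshelve. all: by end_near. Qed.

(** Even second differences at the origin isolate the quadratic part, and
    polarization along the coordinate vectors its entries. *)
Lemma quad_hess_bound c0 w (A : 'M[R]_n) (m r : R) : A^T = A -> 0 < r -> 0 <= m ->
  (forall x, eball 0 r x -> `|quad c0 w A x| <= m) ->
  fnorm A <= (n * n)%:R * (32 * m / r ^+ 2).
Proof.
move=> sA r0 m0 hq.
have r20 : 0 < r ^+ 2 by rewrite exprn_gt0.
have q2 z : eball 0 r z -> `|bform A z z| <= 4 * m.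
  move=> Bz; have BNz : eball 0 r (- z).
    by move: Bz; rewrite !eballE !subr0 fnormN.
  have /ler_normlP[h1 h2] := hq _ Bz; have /ler_normlP[h3 h4] := hq _ BNz.
  have /ler_normlP[h5 h6] := hq 0 (eball_center 0 r0).
  move: h1 h2 h3 h4 h5 h6; rewrite /quad frobNl bformNxl bformNxr opprK.
  rewrite (frobC 0 w) frob0r (_ : bform A 0 0 = 0); last first.
    by rewrite -(scale0r 0) bformZxl mul0r.
  by move=> h1 h2 h3 h4 h5 h6; apply/ler_normlP; split; lra.
apply: fnorm_le_entries; last by rewrite divr_ge0 ?mulr_ge0// ltW.
move=> i j; set x : 'rV[R]_n := (r / 4) *: delta_mx 0 i.
set y : 'rV[R]_n := (r / 4) *: delta_mx 0 j.
have nx : fnorm x = r / 4.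
  by rewrite /x fnormZ fnorm_delta mulr1 ger0_norm// divr_ge0// ltW.
have ny : fnorm y = r / 4.
  by rewrite /y fnormZ fnorm_delta mulr1 ger0_norm// divr_ge0// ltW.
have Bp : eball 0 r (x + y).
  by rewrite eballE subr0 (le_lt_trans (ler_fnormD _ _))// nx ny; lra.
have Bm : eball 0 r (x - y).
  by rewrite eballE subr0 (le_lt_trans (ler_fnormB _ _))// nx ny; lra.
have E : r ^+ 2 * A i j = 4 * (bform A (x + y) (x + y) - bform A (x - y) (x - y)).
  rewrite !(bformDxl, bformDxr, bformNxl, bformNxr) -[bform A y x]bform_tr sA.
  by rewrite /x /y !(bformZxl, bformZxr) !bform_delta; field.
rewrite ler_pdivlMr// -[r ^+ 2]gtr0_norm// -normrM mulrC E.
have /ler_normlP[h1 h2] := q2 _ Bp; have /ler_normlP[h3 h4] := q2 _ Bm.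
by apply/ler_normlP; split; lra.
Qed.

(** Reduces all estimates to the unit ball, by the closure of the family under
    [rescale] at the zero matrix. *)
Lemma normalize G u x (r m : R) : F G -> 0 < r -> 0 < m ->
  viscosity_solutions G (eball x r) u ->
  (forall y, eball x r y -> `|u y - u x| <= m) ->
  exists G' v, normalized G' v /\ forall y, eball 0 1 y ->
    grad v y = (m^-1 * r) *: grad u (x + r *: y) /\
    hess v y = (m^-1 * r ^+ 2) *: hess u (x + r *: y).
Proof.
move=> FG r0 m0 su um.
have cu := family_C2 FG r0 su.
have oB := @open_eball R n x r.
have im0 : 0 < m^-1 by rewrite invr_gt0.
have t0 : 0 < m^-1 * r ^+ 2 by rewrite mulr_gt0// exprn_gt0.
pose B := - (m^-1 * r ^+ 2) *: ((0 : symmx R n) : 'M[R]_n).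
have BE : B = 0 by rewrite /B scaler0.
have sv := viscosity_solutions_affq x (- (m^-1 * u x)) 0 oB r0 im0 (F0 FG) cu su.
have inB y : eball 0 1 y -> eball x r (x + r *: y).
  rewrite !eballE subr0 addrAC subrr add0r fnormZ gtr0_norm// => y1.
  by rewrite gtr_pMr.
exists (rescale 0 (m^-1 * r ^+ 2) G), (affq u x r m^-1 (- (m^-1 * u x)) 0 B).
split.
  split; first by apply: Frescale => //; exact: F0.
    by apply: viscosity_solutions_sub sv => y; exact: inB.
  move=> y /inB /um; rewrite /affq BE quad00 -mulrN -mulrDr => h.
  by rewrite normrM gtr0_norm// ler_pdivrMl// mulr1.
move=> y /inB By; split.
  rewrite /B scaler0 grad_affq ?trmx0//; first by rewrite mulmx0 !addr0.
  by have [] := cu.1 _ By.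
by rewrite /B scaler0 (hess_affq _ _ _ (trmx0 _ _ _) oB cu.1 By) addr0.
Qed.

(** The qualitative hypothesis at the origin; nothing is known about [H]. *)
Lemma fnorm_hess_powR G u : normalized G u ->
  exists2 H : R, 0 <= H & forall y, eball 0 (1 / 2) y ->
    fnorm (hess u y - hess u 0) <= H * fnorm y `^ a.
Proof.
move=> [FG su _]; have [_ holdu] := Freg FG ltr01 su.
have K1 : cball (0 : 'rV[R]_n) (1 / 2) `<=` eball 0 1.
  by move=> y; rewrite cballE eballE; lra.
have [H H0 hH] := holder_seminorm_bound (holdu _ (@compact_cball R n 0 (1 / 2)) K1).
exists H => // y; rewrite eballE subr0 => y2.
have := hH y 0; rewrite !cballE !subr0 fnorm0; apply; first exact: ltW.
by rewrite divr_ge0.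
Qed.

Lemma hess_bound_rough G u (H : R) : normalized G u -> 0 <= H ->
  (forall y, eball 0 (1 / 2) y ->
    fnorm (hess u y - hess u 0) <= H * fnorm y `^ a) ->
  fnorm (hess u 0) <= (n * n)%:R * 128 * (1 + H).
Proof.
move=> Nu H0 hH; have cu := normalized_C2 Nu; have [_ _ u1] := Nu.
have oB := @open_eball R n 0 1.
have a0 : 0 <= a by rewrite (le_trans (ltW b0))// ltW.
have sub12 : eball (0 : 'rV[R]_n) (1 / 2) `<=` eball 0 1.
  by move=> x; rewrite !eballE => /lt_trans; apply; lra.
have cu2 : C2 (eball 0 (1 / 2)) u.
  by split=> x /sub12; [exact: cu.1|exact: cu.2].
have sH := hess_sym oB (eball_center 0 ltr01) cu.
have r0 : 0 < 1 / 2 :> R by rewrite divr_gt0.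
have := @quad_hess_bound (u 0) (grad u 0) (hess u 0) (1 + H) (1 / 2) sH r0 _ _.
rewrite (_ : 32 * (1 + H) / (1 / 2) ^+ 2 = 128 * (1 + H)); last by field.
rewrite mulrA; apply; first by rewrite addr_ge0.
move=> x Bx; have := taylor_holder cu2 Bx H0 a0 hH.
have /u1 ux := sub12 _ Bx.
have x1 : fnorm x <= 1 by move: Bx; rewrite eballE subr0; lra.
have xa : fnorm x `^ a <= 1.
  apply: (@le_trans _ _ (1 `^ a)); last by rewrite powR1.
  by rewrite ge0_ler_powR ?nnegrE ?fnorm_ge0.
have x2 : fnorm x ^+ 2 <= 1 by rewrite expr_le1 ?fnorm_ge0.
have h : H * fnorm x `^ a * fnorm x ^+ 2 <= H.
  rewrite -mulrA ler_piMr// mulr_ile1// ?powR_ge0 ?sqr_ge0//.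
move=> /le_trans /(_ h) {h}.
move: (quad _ _ _ x) => q /ler_normlP[h1 h2]; move/ler_normlP: ux => [h3 h4].
by apply/ler_normlP; split; lra.
Qed.

Section Steps.
Variables (rho0 : R) (rho00 : 0 < rho0).
Hypothesis improve : forall G u, normalized G u ->
  exists rho c0 w A, [/\ rho0 <= rho <= 1 / 4, G A = 0 &
    forall x, eball 0 rho x -> `|u x - quad c0 w A x| <= rho `^ b * rho ^+ 2].

(** The bound of [quad_hess_bound] for a polynomial bounded by 2 on a ball of
    radius at least [rho0]. *)
Definition step_cst : R := (n * n)%:R * (64 / rho0 ^+ 2).

(** One step of the iteration: the remainder after subtraction of the
    approximating polynomial, at the scale of the approximation. *)
Lemma flatness_step G u : normalized G u -> exists rho A G1 u1,
  [/\ rho0 <= rho <= 1 / 4, fnorm (A : 'M[R]_n) <= step_cst, normalized G1 u1 &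
   forall y, eball 0 1 y ->
     hess u (rho *: y) = (A : 'M[R]_n) + rho `^ b *: hess u1 y].
Proof.
move=> Nu; have [FG su ubd] := Nu; have cu := normalized_C2 Nu.
have [rho [c0 [w [A [/andP[r0 r1] GA hq]]]]] := improve Nu.
have rp : 0 < rho by apply: lt_le_trans r0.
have p0 : 0 < rho `^ b by rewrite powR_gt0.
have r20 : 0 < rho ^+ 2 by rewrite exprn_gt0.
pose c := (rho `^ b * rho ^+ 2)^-1; have c_gt0 : 0 < c by rewrite invr_gt0 mulr_gt0.
have ct : c * rho ^+ 2 = (rho `^ b)^-1.
  by rewrite /c invfM -mulrA mulVf ?mulr1// gt_eqF.
have oB := @open_eball R n 0 1.
pose B := - (c * rho ^+ 2) *: (A : 'M[R]_n).
have sB : B^T = B by rewrite linearZ /= symmx_tr.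
pose u1 := affq u 0 rho c (- (c * c0)) (- (c * rho) *: w) B.
have sv := viscosity_solutions_affq 0 (- (c * c0)) (- (c * rho) *: w) oB rp c_gt0 GA cu su.
have inr y : eball 0 1 y -> eball 0 rho (0 + rho *: y).
  by rewrite !eballE !subr0 add0r fnormZ gtr0_norm// => y1; rewrite gtr_pMr.
have inB y : eball 0 1 y -> eball 0 1 (0 + rho *: y).
  by move=> /inr; rewrite !eballE; move: r1; lra.
exists rho, A, (rescale A (c * rho ^+ 2) G), u1; split.
- by rewrite r0 r1.
- have m0 : 0 <= 2 :> R by [].
  have := @quad_hess_bound c0 w A 2 rho (symmx_tr A) rp m0 _.
  rewrite (_ : 32 * 2 = 64 :> R); last by ring.
  move=> h; apply: (le_trans (h _)).
    move=> x Bx; have /ler_normlP[h1 h2] := hq _ Bx.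
    have Bx1 : eball 0 1 x by move: Bx; rewrite !eballE; move: r1; lra.
    have /ler_normlP[h3 h4] := ubd _ Bx1.
    have h5 : rho `^ b * rho ^+ 2 <= 1.
      rewrite mulr_ile1 ?powR_ge0 ?sqr_ge0//; last first.
        by rewrite expr_le1 ?(ltW rp)//; move: r1; lra.
      apply: (@le_trans _ _ (1 `^ b)); last by rewrite powR1.
      by rewrite ge0_ler_powR ?nnegrE ?(ltW b0) ?(ltW rp)//; move: r1; lra.
    by apply/ler_normlP; split; lra.
  rewrite /step_cst ler_wpM2l// ler_wpM2l// lef_pV2 ?posrE ?exprn_gt0//.
  by rewrite lerXn2r ?nnegrE// ltW.
- split; first by apply: Frescale => //; rewrite ct invr_gt0.
    by apply: viscosity_solutions_sub sv => y; exact: inB.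
  move=> y /inr /hq.
  have -> : u1 y = c * (u (0 + rho *: y) - quad c0 w A (0 + rho *: y)).
    rewrite /u1 /affq /quad /B add0r !(bformZl, bformZxl, bformZxr, frobZl, frobZr).
    by field.
  by move=> h; rewrite normrM gtr0_norm// /c ler_pdivrMl ?mulr_gt0// mulr1.
- move=> y /inB By; rewrite /u1 (hess_affq _ _ _ sB oB cu.1 By) -/(c * rho ^+ 2) ct.
  rewrite /B ct add0r; move: (hess u _) => X.
  rewrite scalerDr !scalerA mulrN divff ?gt_eqF// scale1r scaleN1r.
  by rewrite addrCA subrr addr0.
Qed.

End Steps.

Lemma fnorm_affine_diff (A X Y : 'M[R]_n) (s : R) : 0 < s ->
  fnorm (A + s *: X - (A + s *: Y)) = s * fnorm (X - Y).
Proof.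
by move=> s0; rewrite opprD addrACA subrr add0r -scalerBr fnormZ gtr0_norm.
Qed.

Lemma expr_small (t M : R) : 0 <= t < 1 -> exists k : nat, t ^+ k * M <= 1.
Proof.
move=> /andP[t0 t1]; have M0 : 0 < `|M| + 1 by rewrite ltr_wpDl.
have nt : `|t| < 1 by rewrite ger0_norm.
have iM0 : 0 < (`|M| + 1)^-1 by rewrite invr_gt0.
have [k _ hk] := cvgr0_norm_lt _ (cvg_expr nt) _ iM0.
exists k; have := hk k (leqnn k); rewrite /= => h.
apply: (le_trans (ler_norm _)); rewrite normrM.
apply: (@le_trans _ _ (`|t ^+ k| * (`|M| + 1))).
  by rewrite ler_wpM2l// lerDl.
by rewrite -ler_pdivlMr// mul1r ltW.
Qed.

(** All scales are at most 1/4, so each step contracts the Hessian of the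
    remainder by this factor at least. *)
Let theta : R := (1 / 4) `^ b.

Lemma theta01 : 0 <= theta < 1.
Proof.
rewrite powR_ge0 /=; apply: (@lt_le_trans _ _ (1 `^ b)); last by rewrite powR1.
by rewrite gt0_ltr_powR ?nnegrE// ?divr_ge0//; lra.
Qed.

Section Constants.
Variables (rho0 : R) (rho00 : 0 < rho0).
Hypothesis improve : forall G u, normalized G u ->
  exists rho c0 w A, [/\ rho0 <= rho <= 1 / 4, G A = 0 &
    forall x, eball 0 rho x -> `|u x - quad c0 w A x| <= rho `^ b * rho ^+ 2].

Let C0 : R := step_cst rho0 / (1 - theta).

Lemma step_cst_ge0 : 0 <= step_cst rho0.
Proof. by rewrite mulr_ge0// divr_ge0// sqr_ge0. Qed.

Lemma rho_pow (rho : R) : rho0 <= rho <= 1 / 4 -> 0 < rho /\ 0 < rho `^ b <= theta.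
Proof.
move=> /andP[r0 r1]; have rp : 0 < rho by apply: lt_le_trans r0.
split=> //; rewrite powR_gt0//= ge0_ler_powR ?nnegrE ?(ltW b0) ?(ltW rp)//.
Qed.

(** The constant [H] of order [a], although not controlled, is inherited by the
    remainder because [b < a]. It gives the same crude bound for all the
    remainders, whose weight after [k] steps is at most [theta ^+ k]. *)
Lemma hess_bound_iter k G u (H : R) : normalized G u -> 0 <= H ->
  (forall y, eball 0 (1 / 2) y ->
    fnorm (hess u y - hess u 0) <= H * fnorm y `^ a) ->
  fnorm (hess u 0) <= C0 + theta ^+ k * ((n * n)%:R * 128 * (1 + H)).
Proof.
have /andP[th0 th1] := theta01.
have C00 : 0 <= C0 by rewrite divr_ge0 ?step_cst_ge0// subr_ge0 ltW.
elim: k G u => [|k IH] G u Nu H0 hH.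
  by rewrite expr0 mul1r (le_trans (hess_bound_rough Nu H0 hH))// lerDr.
have [rho [A [G1 [u1 [rr nA N1 hu]]]]] := flatness_step rho00 improve Nu.
have [rp /andP[p0 pth]] := rho_pow rr.
have B10 := eball_center (0 : 'rV[R]_n) (@ltr01 R).
have h0 := hu 0 B10; rewrite scaler0 in h0.
have hH1 y : eball 0 (1 / 2) y ->
    fnorm (hess u1 y - hess u1 0) <= H * fnorm y `^ a.
  move=> By.
  have B1y : eball 0 1 y by move: By; rewrite !eballE => /lt_trans; apply; lra.
  have By' : eball 0 (1 / 2) (rho *: y).
    move: By; rewrite !eballE !subr0 fnormZ gtr0_norm// => y2.
    apply: le_lt_trans y2; rewrite ler_piMl ?fnorm_ge0//.
    by case/andP: rr; lra.
  have := hH _ By'; rewrite (hu y B1y) h0; move: (hess u1) => X.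
  rewrite (fnorm_affine_diff _ _ _ p0) fnormZ (gtr0_norm rp) powRM ?(ltW rp) ?fnorm_ge0//.
  have -> : a = b + (a - b) by rewrite addrC subrK.
  rewrite powRD; last by apply/implyP => _; rewrite gt_eqF.
  rewrite -mulrA mulrCA ler_pM2l// => /le_trans; apply.
  rewrite mulrCA ler_piMl ?mulr_ge0 ?powR_ge0//.
  apply: (@le_trans _ _ (1 `^ (a - b))); last by rewrite powR1.
  rewrite ge0_ler_powR ?nnegrE ?(ltW rp) ?subr_ge0 ?(ltW ba)//.
  by case/andP: rr; lra.
have h1 := IH _ _ N1 H0 hH1.
rewrite h0; move: (hess u1 0) h1 => X h1.
apply: (le_trans (ler_fnormD _ _)); rewrite fnormZ gtr0_norm//.
have h2 : rho `^ b * fnorm X <= theta * (C0 + theta ^+ k * ((n * n)%:R * 128 * (1 + H))).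
  by rewrite ler_pM ?fnorm_ge0// ltW.
have E : C0 = step_cst rho0 + theta * C0.
  by rewrite /C0; field; rewrite subr_eq0 gt_eqF.
rewrite {1}E exprS -mulrA -addrA -mulrDr.
exact: lerD.
Qed.

Lemma hess_bound0 G u : normalized G u -> fnorm (hess u 0) <= C0 + 1.
Proof.
move=> Nu; have [H H0 hH] := fnorm_hess_powR Nu.
have [k hk] := expr_small ((n * n)%:R * 128 * (1 + H)) theta01.
by apply: (le_trans (hess_bound_iter k Nu H0 hH)); rewrite lerD2l.
Qed.

(** Carries bounds at the origin over to the points of the half ball. *)
Lemma normalize_half G u x : normalized G u -> eball 0 (1 / 2) x ->
  exists G' v, normalized G' v /\ hess v 0 = 8^-1 *: hess u x.
Proof.
move=> Nu Bx; have [FG su u1] := Nu.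
have sub : eball x (1 / 2) `<=` eball 0 1.
  move=> y; move: Bx; rewrite !eballE !subr0 => Bx By.
  by rewrite -(subrK x y) (le_lt_trans (ler_fnormD _ _))//; lra.
have r20 : 0 < 1 / 2 :> R by rewrite divr_gt0.
have h2 y : eball x (1 / 2) y -> `|u y - u x| <= 2.
  move=> /sub/u1/ler_normlP[h1 h2].
  have /sub/u1/ler_normlP[h3 h4] := eball_center x r20.
  by apply/ler_normlP; split; lra.
have [G' [v [Nv hv]]] := normalize FG r20 (ltr0n _ 2)
  (viscosity_solutions_sub sub su) h2.
exists G', v; split=> //; have [_ ->] := hv 0 (eball_center 0 ltr01).
by rewrite scaler0 addr0; congr (_ *: _); field.
Qed.

Lemma hess_bound G u x : normalized G u -> eball 0 (1 / 2) x ->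
  fnorm (hess u x) <= 8 * (C0 + 1).
Proof.
move=> Nu Bx; have [G' [v [Nv hv]]] := normalize_half Nu Bx.
have := hess_bound0 Nv; rewrite hv fnormZ ger0_norm ?invr_ge0//.
by rewrite ler_pdivrMl.
Qed.

(** The bound on the difference of two Hessians, and the loss for points whose
    norm is at least half of a scale that may be as small as [rho0]. *)
Let C3 : R := 2 * (8 * (C0 + 1)) * (2 / rho0) `^ b.

(** Induction on the number of steps needed to bring [y] to a size comparable to
    the scale: there the bound on the Hessians suffices, and before that the
    difference of the Hessians scales exactly like [fnorm y `^ b]. *)
Lemma holder0_iter k G u y : normalized G u -> eball 0 (1 / 2) y ->
  (1 / 4) ^+ k / 2 <= fnorm y ->
  fnorm (hess u y - hess u 0) <= C3 * fnorm y `^ b.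
Proof.
have /andP[th0 th1] := theta01.
have C00 : 0 <= C0 by rewrite divr_ge0 ?step_cst_ge0// subr_ge0 ltW.
have r20 : 0 < 1 / 2 :> R by rewrite divr_gt0.
elim: k G u y => [|k IH] G u y Nu By yk.
  by move: By yk; rewrite eballE subr0 expr0; lra.
have [rho [A [G1 [u1 [rr nA N1 hu]]]]] := flatness_step rho00 improve Nu.
have [rp /andP[p0 pth]] := rho_pow rr.
have [big|small] := leP (rho / 2) (fnorm y).
  have h1 := hess_bound Nu By; have h2 := hess_bound Nu (eball_center 0 r20).
  apply: (le_trans (ler_fnormB _ _)).
  apply: (@le_trans _ _ (2 * (8 * (C0 + 1)))).
    have -> : 2 * (8 * (C0 + 1)) = 8 * (C0 + 1) + 8 * (C0 + 1) by ring.
    exact: (lerD h1 h2).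
  rewrite /C3 -mulrA -powRM ?fnorm_ge0 ?divr_ge0 ?(ltW rho00)//.
  rewrite ler_peMr ?mulr_ge0 ?addr_ge0//.
  apply: (@le_trans _ _ (1 `^ b)); first by rewrite powR1.
  rewrite ge0_ler_powR ?nnegrE ?(ltW b0) ?mulr_ge0 ?fnorm_ge0 ?invr_ge0 ?(ltW rho00)//.
  rewrite mulrAC ler_pdivlMr// mul1r.
  by case/andP: rr => /le_trans h _; apply: h; rewrite -ler_pdivrMl// mulrC.
pose y' := rho^-1 *: y.
have yE : y = rho *: y' by rewrite /y' scalerA mulfV ?scale1r// gt_eqF.
have ny' : fnorm y = rho * fnorm y' by rewrite yE fnormZ gtr0_norm.
have By' : eball 0 (1 / 2) y'.
  by rewrite eballE subr0 -(ltr_pM2l rp) -ny'; lra.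
have yk' : (1 / 4) ^+ k / 2 <= fnorm y'.
  rewrite -(ler_pM2l rp) -ny'; apply: le_trans yk.
  rewrite exprS -mulrA ler_wpM2r ?divr_ge0 ?exprn_ge0 ?divr_ge0//.
  by case/andP: rr.
have B1y' : eball 0 1 y' by move: By'; rewrite !eballE => /lt_trans; apply; lra.
have h0 := hu 0 (eball_center 0 ltr01); rewrite scaler0 in h0.
have hy := hu y' B1y'; rewrite -yE in hy.
rewrite hy h0; have := IH _ _ _ N1 By' yk'; move: (hess u1) => X h.
rewrite (fnorm_affine_diff _ _ _ p0) ny'.
by rewrite powRM ?(ltW rp) ?fnorm_ge0// mulrCA ler_pM2l.
Qed.

Lemma holder0 G u y : normalized G u -> eball 0 (1 / 2) y ->
  fnorm (hess u y - hess u 0) <= C3 * fnorm y `^ b.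
Proof.
move=> Nu By; have [y0|y0] := eqVneq (fnorm y) 0.
  rewrite y0 (fnorm0_eq0 y0) subrr fnorm0 mulr_ge0 ?powR_ge0//.
  have /andP[_ th1] := theta01.
  have C00 : 0 <= C0 by rewrite divr_ge0 ?step_cst_ge0// subr_ge0 ltW.
  by rewrite mulr_ge0 ?powR_ge0// !mulr_ge0// addr_ge0.
have yp : 0 < fnorm y by rewrite lt_def y0 fnorm_ge0.
have t01 : 0 <= (1 / 4 : R) < 1 by apply/andP; split; lra.
have [k hk] := expr_small (fnorm y)^-1 t01.
apply: (holder0_iter (k := k) Nu By).
rewrite ler_pdivrMr// in hk; rewrite ler_pdivrMr//.
by move: hk yp; rewrite mul1r; lra.
Qed.

Lemma grad_bound G u : normalized G u -> fnorm (grad u 0) <= lip_cst.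
Proof.
move=> Nu; have r20 : 0 < 1 / 2 :> R by rewrite divr_gt0.
apply: (@grad_le_lipschitz R n u 0 _ (1 / 2)) => //.
- have [du _] := normalized_C2 Nu.
  by have [] := du 0 (eball_center 0 ltr01).
- by have := lip_cst_ge; lra.
- move=> y By; apply: (normalized_lipschitz Nu By).
  exact: eball_center.
Qed.

End Constants.

(** Normalization divides by a bound on the oscillation, which may vanish;
    hence positive bounds [m] are used, and then let tend to [o]. *)
Lemma le_of_le_above (X K o : R) : 0 <= K ->
  (forall m, 0 < m -> o <= m -> X <= K * m) -> 0 <= o -> X <= K * o.
Proof.
move=> K0 h o0; apply/ler_addgt0Pr => eps eps0.
have K1 : 0 < K + 1 by rewrite ltr_wpDl.
have e0 : 0 < eps / (K + 1) by rewrite divr_gt0.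
apply: (le_trans (h (o + eps / (K + 1)) _ _)); rewrite ?lerDl ?(ltW e0)//.
  by rewrite ltr_wpDl.
rewrite mulrDr lerD2l mulrCA ger_pMr// ler_pdivrMr// mul1r.
by rewrite lerDl.
Qed.

(** [normalize] is applied on the balls of radius [r / 2] around the points [x]
    of the half ball. Pairs of points closer than [r / 4] are covered by
    [holder0], the others by the bound on the Hessians. *)
Lemma interior_estimate : exists2 C : R, 0 <= C &
  forall G x0 (r o : R) u, F G -> 0 < r -> 0 <= o ->
  viscosity_solutions G (eball x0 r) u ->
  (forall y z, eball x0 r y -> eball x0 r z -> `|u y - u z| <= o) ->
  forall x, eball x0 (r / 2) x ->
  [/\ r * fnorm (grad u x) <= C * o, r ^+ 2 * fnorm (hess u x) <= C * o &
   forall x', eball x0 (r / 2) x' ->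
     r `^ (2 + b) * fnorm (hess u x - hess u x') <= C * fnorm (x - x') `^ b * o].
Proof.
have [rho0 rho00 improve] := improvement.
pose K1 := step_cst rho0 / (1 - theta) + 1.
pose K3 := 2 * (8 * K1) * (2 / rho0) `^ b.
pose Kg := lip_cst.
have /andP[th0 th1] := theta01.
have K10 : 0 <= K1.
  by rewrite addr_ge0// divr_ge0 ?step_cst_ge0// subr_ge0 ltW.
have K30 : 0 <= K3 by rewrite !mulr_ge0// powR_ge0.
have Kg0 : 0 <= Kg by have := lip_cst_ge; rewrite /Kg; lra.
pose C := 2 * Kg + 4 * K1 + (4 * K3 * 2 `^ b + 8 * K1 * 4 `^ b).
have p2 : 0 <= 4 * K3 * 2 `^ b by rewrite !mulr_ge0// powR_ge0.
have p4 : 0 <= 8 * K1 * 4 `^ b by rewrite !mulr_ge0// powR_ge0.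
have C0 : 0 <= C by rewrite /C; lra.
have Cg : 2 * Kg <= C by rewrite /C; lra.
have C1 : 4 * K1 <= C by rewrite /C; lra.
have C2' : 4 * K3 * 2 `^ b <= C by rewrite /C; lra.
have C3 : 8 * K1 * 4 `^ b <= C by rewrite /C; lra.
clearbody C.
exists C => // G x0 r o u FG r0 o0 su uo x Bx.
have r20 : 0 < r / 2 by rewrite divr_gt0.
have subx x' : eball x0 (r / 2) x' -> eball x' (r / 2) `<=` eball x0 r.
  rewrite eballE => Bx' y; rewrite !eballE => By.
  by rewrite (le_lt_trans (ler_fnorm_dist x' _ _))//; lra.
have sub := subx x Bx.
have half1 (t : R) : t < 1 / 2 -> t < 1 by lra.
have half2 (t : R) : 1 / 2 <= t -> 1 <= 2 * t by lra.
have Bxr : eball x0 r x by apply: sub; exact: eball_center.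
have main (m : R) : 0 < m -> o <= m -> [/\ r * fnorm (grad u x) <= C * m,
  r ^+ 2 * fnorm (hess u x) <= C * m &
   forall x', eball x0 (r / 2) x' ->
     r `^ (2 + b) * fnorm (hess u x - hess u x') <= C * fnorm (x - x') `^ b * m].
  move=> m0 om.
  have um y : eball x (r / 2) y -> `|u y - u x| <= m.
    by move=> /sub By; exact: le_trans (uo _ _ By Bxr) om.
  have [G' [v [Nv hv]]] := normalize FG r20 m0
    (viscosity_solutions_sub sub su) um.
  have [hg hh] := hv 0 (eball_center 0 ltr01); rewrite scaler0 addr0 in hg hh.
  have gb := grad_bound Nv.
  have hb := hess_bound0 rho00 improve Nv.
  have ho y := @holder0 rho0 rho00 improve G' v y Nv.
  rewrite -/K1 -/K3 -/Kg in gb hb ho.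
  have mr0 : 0 < m^-1 * (r / 2) by rewrite mulr_gt0// invr_gt0.
  have mr20 : 0 < m^-1 * (r / 2) ^+ 2 by rewrite mulr_gt0 ?exprn_gt0// invr_gt0.
  have E2 q : r ^+ 2 * q = 4 * (m^-1 * (r / 2) ^+ 2 * q) * m.
    by field; rewrite gt_eqF.
  have hb' : r ^+ 2 * fnorm (hess u x) <= 4 * K1 * m.
    rewrite E2 ler_pM2r// ler_pM2l//.
    by move: hb; rewrite hh fnormZ gtr0_norm.
  split.
  - have -> : r * fnorm (grad u x) = 2 * (m^-1 * (r / 2) * fnorm (grad u x)) * m.
      by field; rewrite gt_eqF.
    rewrite ler_pM2r//; apply: le_trans Cg; rewrite ler_pM2l//.
    by move: gb; rewrite hg fnormZ gtr0_norm.
  - by apply: (le_trans hb'); rewrite ler_pM2r.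
  - move=> x' Bx'.
    pose y := (r / 2)^-1 *: (x' - x).
    have yE : x' = x + (r / 2) *: y.
      by rewrite /y scalerA mulfV ?gt_eqF// scale1r addrC subrK.
    have ny : fnorm (x - x') = r / 2 * fnorm y.
      by rewrite fnorm_distC {1}yE addrAC subrr add0r fnormZ gtr0_norm.
    have rb : r `^ (2 + b) = r `^ b * r ^+ 2.
      rewrite powRD ?powR_mulrn ?(ltW r0)// 1?mulrC//.
      by apply/implyP => _; rewrite gt_eqF.
    have pb0 : 0 <= r `^ b by exact: powR_ge0.
    have yb : fnorm (x - x') `^ b = r `^ b * (fnorm y / 2) `^ b.
      rewrite ny -powRM ?(ltW r0) ?divr_ge0 ?fnorm_ge0//.
      by congr (_ `^ b); ring.
    rewrite rb yb -mulrA [C * _]mulrCA -[X in _ <= X]mulrA ler_wpM2l//.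
    have [small|big] := ltP (fnorm y) (1 / 2).
      have By : eball 0 (1 / 2) y by rewrite eballE subr0.
      have B1y : eball 0 1 y by rewrite eballE subr0; exact: half1.
      have [_ hy] := hv y B1y; rewrite -yE in hy.
      have := ho y By; rewrite hy hh.
      move: (hess u x) (hess u x') => X X'.
      rewrite -scalerBr fnormZ gtr0_norm// => h.
      rewrite fnorm_distC E2 ler_pM2r//.
      apply: (@le_trans _ _ (4 * (K3 * fnorm y `^ b))); first by rewrite ler_pM2l.
      have -> : fnorm y `^ b = 2 `^ b * (fnorm y / 2) `^ b.
        rewrite -powRM ?divr_ge0 ?fnorm_ge0//.
        by congr (_ `^ b); field.
      have q0 := powR_ge0 (fnorm y / 2) b.
      move: ((fnorm y / 2) `^ b) q0 => q q0.
      have -> : 4 * (K3 * (2 `^ b * q)) = 4 * K3 * 2 `^ b * q by ring.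
      exact: ler_wpM2r q0 _ _ C2'.
    have sub' := subx x' Bx'.
    have Bx'r : eball x0 r x' by apply: sub'; exact: eball_center.
    have um' z : eball x' (r / 2) z -> `|u z - u x'| <= m.
      by move=> /sub' Bz; exact: le_trans (uo _ _ Bz Bx'r) om.
    have [G2 [v2 [Nv2 hv2]]] := normalize FG r20 m0
      (viscosity_solutions_sub sub' su) um'.
    have [_ hh2] := hv2 0 (eball_center 0 ltr01); rewrite scaler0 addr0 in hh2.
    have hb2 := hess_bound0 rho00 improve Nv2.
    rewrite -/K1 hh2 fnormZ gtr0_norm// in hb2.
    have hb2' : r ^+ 2 * fnorm (hess u x') <= 4 * K1 * m.
      by rewrite E2 ler_pM2r// ler_pM2l.
    move: hb' hb2'; move: (hess u x) (hess u x') => X X' h1 h2.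
    have r2p : 0 <= r ^+ 2 by rewrite sqr_ge0.
    apply: (le_trans (ler_wpM2l r2p (ler_fnormB _ _))).
    rewrite mulrDr; apply: (le_trans (lerD h1 h2)).
    rewrite -mulrDl ler_pM2r// -mulrDl.
    have b1 : 1 <= (2 * fnorm y) `^ b.
      apply: (@le_trans _ _ (1 `^ b)); first by rewrite powR1.
      rewrite ge0_ler_powR ?nnegrE ?(ltW b0) ?mulr_ge0 ?fnorm_ge0//.
      exact: half2.
    have E4 : (2 * fnorm y) `^ b = 4 `^ b * (fnorm y / 2) `^ b.
      rewrite -powRM ?divr_ge0 ?fnorm_ge0//.
      by congr (_ `^ b); field.
    apply: (@le_trans _ _ (8 * K1 * (2 * fnorm y) `^ b)).
      rewrite (_ : (4 + 4) * K1 = 8 * K1); last by ring.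
      by rewrite ler_peMr// mulr_ge0.
    have q0 := powR_ge0 (fnorm y / 2) b.
    rewrite E4; move: ((fnorm y / 2) `^ b) q0 => q q0.
    have -> : 8 * K1 * (4 `^ b * q) = 8 * K1 * 4 `^ b * q by ring.
    exact: ler_wpM2r q0 _ _ C3.
split.
- by apply: le_of_le_above => // m m0 om; have [] := main m m0 om.
- by apply: le_of_le_above => // m m0 om; have [] := main m m0 om.
- move=> x' Bx'; apply: le_of_le_above => //.
    by rewrite mulr_ge0 ?powR_ge0.
  by move=> m m0 om; have [_ _] := main m m0 om; apply.
Qed.

End Family.

(** * Oscillation, suprema and Hoelder seminorms *)

Section ExtendedReals.
Variables (R : realType) (n : nat).
Implicit Types (u : 'rV[R]_n -> R) (x y z : 'rV[R]_n) (E W : set 'rV[R]_n).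

Lemma osc_fin E u x : E x -> (osc E u < +oo)%E -> exists o : R,
  [/\ 0 <= o, osc E u = o%:E &
    forall y z, E y -> E z -> `|u y - u z| <= o].
Proof.
move=> Ex; rewrite /osc.
set S := ereal_sup _; set I := ereal_inf _.
have hS y : E y -> ((u y)%:E <= S)%E by move=> Ey; apply: ereal_sup_ubound; exists y.
have hI y : E y -> (I <= (u y)%:E)%E by move=> Ey; apply: ereal_inf_lbound; exists y.
case: S I hS hI => [s| |] [i| |] hS hI fin //;
  try (by have := hS _ Ex); try (by have := hI _ Ex).
have {}hS y : E y -> u y <= s by move=> /hS; rewrite lee_fin.
have {}hI y : E y -> i <= u y by move=> /hI; rewrite lee_fin.
exists (s - i); split => //.
  by have := hS _ Ex; have := hI _ Ex; lra.
move=> y z Ey Ez; have := hS _ Ey; have := hI _ Ey; have := hS _ Ez.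
by have := hI _ Ez => *; apply/ler_normlP; split; lra.
Qed.

Lemma osc_le E u x (d : R) : E x -> (forall y, E y -> `|u y - u x| <= d) ->
  (0 <= osc E u)%E /\ (osc E u <= (2 * d)%:E)%E.
Proof.
move=> Ex hd; rewrite /osc.
have h1 : (ereal_sup [set (u y)%:E | y in E] <= (u x + d)%:E)%E.
  apply: ge_ereal_sup => _ [y Ey <-]; rewrite lee_fin.
  by have /ler_normlP[] := hd y Ey; lra.
have h2 : ((u x - d)%:E <= ereal_inf [set (u y)%:E | y in E])%E.
  apply: le_ereal_inf_tmp => _ [y Ey <-]; rewrite lee_fin.
  by have /ler_normlP[] := hd y Ey; lra.
have h3 : ((u x)%:E <= ereal_sup [set (u y)%:E | y in E])%E.
  by apply: ereal_sup_ubound; exists x.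
have h4 : (ereal_inf [set (u y)%:E | y in E] <= (u x)%:E)%E.
  by apply: ereal_inf_lbound; exists x.
split.
  by rewrite -(subee (x := (u x)%:E))// leeB.
apply: (le_trans (leeB h1 h2)); rewrite -EFinB lee_fin; lra.
Qed.

Lemma sup_norm_le p q E (g : 'rV[R]_n -> 'M[R]_(p, q)) (c M : R) : 0 < c ->
  (forall x, E x -> c * fnorm (g x) <= M) ->
  (c%:E * sup_norm E g <= M%:E)%E.
Proof.
move=> c0 h; rewrite muleC -lee_pdivlMr//; apply: ge_ereal_sup => _ [x Ex <-].
by rewrite lee_fin ler_pdivlMr// mulrC h.
Qed.

Lemma sup_norm_ge0 p q E (g : 'rV[R]_n -> 'M[R]_(p, q)) x : E x ->
  (0 <= sup_norm E g)%E.
Proof.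
move=> Ex; apply: (@le_trans _ _ (fnorm (g x))%:E).
  by rewrite lee_fin fnorm_ge0.
by apply: ereal_sup_ubound; exists x.
Qed.

Lemma holder_seminorm_le p q (a c M : R) E (g : 'rV[R]_n -> 'M[R]_(p, q)) : 0 < c ->
  (forall x y, E x -> E y -> c * fnorm (g x - g y) <= M * fnorm (x - y) `^ a) ->
  (c%:E * holder_seminorm a E g <= M%:E)%E.
Proof.
move=> c0 h; rewrite muleC -lee_pdivlMr//; apply: ge_ereal_sup => _ [[x y] /= [Ex Ey xy] <-].
have nxy : 0 < fnorm (x - y).
  rewrite lt_def fnorm_ge0 andbT; apply/eqP => /fnorm0_eq0/eqP.
  by rewrite subr_eq0 (negbTE xy).
by rewrite lee_fin ler_pdivlMr// mulrAC ler_pdivrMr ?powR_gt0// mulrC h.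
Qed.

(** By compactness of [K `*` K]: near the diagonal the local bounds apply, and
    away from it boundedness suffices. *)
Lemma locally_holder_compact p q (a : R) W (g : 'rV[R]_n -> 'M[R]_(p, q)) (K : set 'rV[R]_n) :
  0 < a -> (forall x, W x -> exists2 s : R, 0 < s & exists2 H : R, 0 <= H &
    forall y z, eball x s y -> eball x s z ->
      fnorm (g y - g z) <= H * fnorm (y - z) `^ a) ->
  compact K -> K `<=` W -> (holder_seminorm a K g < +oo)%E.
Proof.
move=> a0 loc cK KW.
have cKK : compact (K `*` K) by exact: compact_setX.
suff [M hM] : exists M : R, forall p, (K `*` K) p ->
    fnorm (g p.1 - g p.2) <= M * fnorm (p.1 - p.2) `^ a.
  apply: (@le_lt_trans _ _ M%:E); last exact: ltry.
  have := @holder_seminorm_le _ _ a 1 M K g ltr01; rewrite mul1e; apply.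
  by move=> x y Kx Ky; rewrite mul1r; exact: (hM (x, y)).
move/compact_near_coveringP : cKK => /(_ R (+oo)%R
  (fun M p => fnorm (g p.1 - g p.2) <= M * fnorm (p.1 - p.2) `^ a) _) [].
  move=> [x x'] [/= /KW Wx /KW Wx'].
  have [s s0 [H H0 hH]] := loc x Wx; have [s' s'0 [H' H'0 hH']] := loc x' Wx'.
  have [->|xx'] := eqVneq x x'.
    exists ((eball x' s' `*` eball x' s'), [set M | H' <= M]) => /=.
      split; last by apply: nbhs_pinfty_ge; exact: num_real.
      by exists (eball x' s', eball x' s') => //=; split; exact: nbhs_eball.
    move=> [[y z] M] /= [[By Bz] HM]; apply: (le_trans (hH' _ _ By Bz)).
    by rewrite ler_wpM2r ?powR_ge0.
  pose d := fnorm (x - x').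
  have d0 : 0 < d.
    rewrite lt_def fnorm_ge0 andbT; apply/eqP => /fnorm0_eq0/eqP.
    by rewrite subr_eq0 (negbTE xx').
  have d4 : 0 < d / 4 by rewrite divr_gt0.
  have d2 : 0 < d / 2 by rewrite divr_gt0.
  pose r := Num.min s (d / 4); pose r' := Num.min s' (d / 4).
  have r0 : 0 < r by rewrite lt_min s0.
  have r'0 : 0 < r' by rewrite lt_min s'0.
  pose B := H * s `^ a + H' * s' `^ a + fnorm (g x - g x').
  have B0 : 0 <= B by rewrite !addr_ge0 ?mulr_ge0 ?powR_ge0 ?fnorm_ge0.
  exists ((eball x r `*` eball x' r'), [set M | B / (d / 2) `^ a <= M]) => /=.
    split; last by apply: nbhs_pinfty_ge; exact: num_real.
    by exists (eball x r, eball x' r') => //=; split; exact: nbhs_eball.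
  move=> [[y z] M] /= [[]]; rewrite !eballE !lt_min => /andP[ys yd] /andP[zs zd] BM.
  have yz : d / 2 <= fnorm (y - z).
    have h1 := ler_fnorm_dist y x x'; have h2 := ler_fnorm_dist z y x'.
    by rewrite (fnorm_distC x y) -/d in h1; lra.
  have h1 : fnorm (g y - g x) <= H * s `^ a.
    apply: (le_trans (hH _ _ ys (eball_center x s0))); rewrite ler_wpM2l//.
    by rewrite ge0_ler_powR ?nnegrE ?fnorm_ge0// ltW.
  have h2 : fnorm (g x' - g z) <= H' * s' `^ a.
    apply: (le_trans (hH' _ _ (eball_center x' s'0) zs)); rewrite ler_wpM2l//.
    by rewrite fnorm_distC ge0_ler_powR ?nnegrE ?fnorm_ge0// ltW.
  have h3 : fnorm (g y - g z) <= B.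
    apply: (le_trans (ler_fnorm_dist (g x) _ _)).
    have := ler_fnorm_dist (g x') (g x) (g z); rewrite /B; lra.
  apply: (le_trans h3).
  have M0 : 0 <= M.
    by apply: le_trans BM; rewrite divr_ge0 ?powR_ge0.
  apply: (@le_trans _ _ (M * (d / 2) `^ a)).
    by rewrite -ler_pdivrMr ?powR_gt0.
  by rewrite ler_wpM2l// ge0_ler_powR ?nnegrE ?fnorm_ge0// ltW.
move=> M [_ /(_ (M + 1))] h; exists (M + 1) => t Kt.
by apply: h => //; rewrite ltrDl.
Qed.

End ExtendedReals.

(** * Comparison of the exponents *)

Section Exponents.
Variables (R : realType) (n : nat) (lam Lam : R) (F : set (symmx R n -> R)).
Hypotheses (n0 : (0 < n)%N) (lam0 : 0 < lam).
Hypothesis Fell : F `<=` elliptic lam Lam.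
Hypothesis Fcompact : compact (F : set {family compact, symmx R n -> R}).
Hypothesis Frescale : forall G A t, F G -> G A = 0 -> 0 < t -> F (rescale A t G).

(** A solution is continuous, so its oscillation is finite on a small ball
    around each point, and the estimate there gives Hoelder continuity of the
    Hessian near the point. *)
Lemma estimate_sub_qualitative :
  estimate_exponents F `<=` qualitative_exponents F.
Proof.
move=> al [/andP[al0 al1] [C hC]]; split; first by rewrite al0 al1.
move=> G x0 r FG r0 u su.
have oW := @open_eball R n x0 r.
have loc x : eball x0 r x -> exists2 s : R, 0 < s &
    twice_differentiable (eball x s) u /\ exists2 H : R, 0 <= H &
    forall y z, eball x s y -> eball x s z ->
      fnorm (hess u y - hess u z) <= H * fnorm (y - z) `^ al.
  move=> Wx; have [cu _ _] := su.
  have /nbhs_eballP[d1 d10 Wd1] : nbhs x (eball x0 r) by exact: open_nbhs_nbhs.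
  have [d2 d20 hd2] := (continuous_eballP u x).1 (cu x Wx) _ ltr01.
  pose d := Num.min d1 d2; have d0 : 0 < d by rewrite lt_min d10.
  have Wd : eball x d `<=` eball x0 r.
    by move=> y; rewrite eballE lt_min => /andP[yd1 _]; exact: Wd1.
  have [osc0 osc2] : (0 <= osc (eball x d) u)%E /\ (osc (eball x d) u <= (2 * 1)%:E)%E.
    apply: (osc_le (eball_center x d0)) => y; rewrite eballE lt_min => /andP[_ yd2].
    by rewrite distrC ltW// hd2.
  have oscoo : (osc (eball x d) u < +oo)%E by apply: le_lt_trans osc2 _; exact: ltry.
  have [tw est] := hC G x d u FG d0 (viscosity_solutions_sub Wd su) oscoo.
  have dd0 : 0 < d / 2 by rewrite divr_gt0.
  exists (d / 2) => //; split => //.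
  apply: holder_seminorm_bound.
  have xd := eball_center x dd0.
  have g0 := sup_norm_ge0 (grad u) xd; have h0 := sup_norm_ge0 (hess u) xd.
  rewrite ltey; apply/eqP => Hoo; move: est; rewrite Hoo.
  have p0 : 0 < d `^ (2 + al) by rewrite powR_gt0.
  rewrite gt0_muley ?lte_fin//.
  have -> : osc (eball x d) u = (fine (osc (eball x d) u))%:E.
    rewrite fineK// fin_numElt oscoo andbT (lt_le_trans _ osc0)//.
  rewrite addey; first by rewrite -EFinM.
  rewrite gt_eqF// (@lt_le_trans _ _ 0%E)//.
  by rewrite adde_ge0// mule_ge0// lee_fin// ltW// exprn_gt0.
split.
  split.
    move=> x Wx; have [s s0 [tw _]] := loc x Wx.
    by apply: tw; exact: eball_center.
  move=> x Wx; have [s s0 [_ [H H0 hH]]] := loc x Wx.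
  apply/continuous_mx_eballP => eps eps0.
  have H1 : 0 < H + 1 by rewrite ltr_wpDl.
  have e0 : 0 < eps / (H + 1) by rewrite divr_gt0.
  exists (Num.min s ((eps / (H + 1)) `^ al^-1)).
    by rewrite lt_min s0 powR_gt0.
  move=> y; rewrite eballE lt_min => /andP[ys ye].
  apply: (le_lt_trans (hH x y (eball_center x s0) ys)).
  have h : fnorm (x - y) `^ al <= eps / (H + 1).
    rewrite fnorm_distC (@le_trans _ _ (((eps / (H + 1)) `^ al^-1) `^ al))//.
      by rewrite ge0_ler_powR ?nnegrE ?fnorm_ge0 ?powR_ge0// ltW.
    by rewrite -powRrM mulVf ?powRr1 ?(ltW e0)// gt_eqF.
  apply: (@le_lt_trans _ _ (H * (eps / (H + 1)))); first by rewrite ler_wpM2l.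
  by rewrite mulrA ltr_pdivrMr// mulrC ltr_pM2l// ltrDl.
move=> K cK KW; apply: (locally_holder_compact al0 _ cK KW) => x Wx.
by have [s s0 [_ hH]] := loc x Wx; exists s.
Qed.

(** The three terms are at most [C] times the oscillation each; the suprema are
    over a ball on which the solution is known to be twice differentiable. *)
Lemma qualitative_estimate (a b : R) : qualitative_exponents F a ->
  0 < b -> b < a -> estimate_exponents F b.
Proof.
move=> [/andP[a0 a1] reg] b0 ba; split.
  by rewrite b0 (le_trans (ltW ba)).
have Fell' G : F G -> uniform_ellipticity lam Lam G by move=> /Fell[].
have F0 G : F G -> G 0 = 0 by move=> /Fell[].
have [C C0 hC] := interior_estimate n0 lam0 Fell' F0 Fcompact Frescale reg b0 ba.
exists (3 * C) => G x0 r u FG r0 su oscoo.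
have r20 : 0 < r / 2 by rewrite divr_gt0.
have sub : eball x0 (r / 2) `<=` eball x0 r.
  by move=> y; rewrite !eballE => /lt_trans; apply; lra.
have [[tw _] _] := reg G x0 r FG r0 u su.
have [m [m0 -> hm]] := osc_fin (eball_center x0 r0) oscoo.
have est := hC G x0 r m u FG r0 m0 su hm.
split; first by move=> x /sub; exact: tw.
have e1 : (r%:E * sup_norm (eball x0 (r / 2)) (grad u) <= (C * m)%:E)%E.
  by apply: sup_norm_le => // x Bx; have [] := est x Bx.
have e2 : ((r ^+ 2)%:E * sup_norm (eball x0 (r / 2)) (hess u) <= (C * m)%:E)%E.
  apply: sup_norm_le; first by rewrite exprn_gt0.
  by move=> x Bx; have [] := est x Bx.
have e3 : ((r `^ (2 + b))%:E * holder_seminorm b (eball x0 (r / 2)) (hess u)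
    <= (C * m)%:E)%E.
  apply: holder_seminorm_le; first by rewrite powR_gt0.
  by move=> x y Bx By; have [_ _ h] := est x Bx; rewrite mulrAC; exact: h.
apply: (le_trans (leeD (leeD e1 e2) e3)).
by rewrite -!EFinD -EFinM lee_fin; lra.
Qed.

Lemma sup_exponents : qualitative_exponents F !=set0 ->
  sup (qualitative_exponents F) = sup (estimate_exponents F).
Proof.
move=> Q0.
have E0 : estimate_exponents F !=set0.
  have [a Qa] := Q0; have [/andP[a0 _] _] := Qa.
  exists (a / 2); apply: (qualitative_estimate Qa); first by rewrite divr_gt0.
  by lra.
have ubQ : ubound (qualitative_exponents F) 1 by move=> a [/andP[_ a1] _].
have ubE : ubound (estimate_exponents F) 1 by move=> a [/andP[_ a1] _].
apply/eqP; rewrite eq_le; apply/andP; split; apply: ge_sup => //.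
  move=> a Qa; apply/ler_addgt0Pr => eps eps0.
  have [/andP[a0 _] _] := Qa.
  pose b := Num.max (a / 2) (a - eps).
  have b0 : 0 < b by rewrite lt_max divr_gt0.
  have ba : b < a by rewrite gt_max; apply/andP; split; lra.
  have Eb := qualitative_estimate Qa b0 ba.
  have h1 : b <= sup (estimate_exponents F) by apply: ub_le_sup => //; exists 1.
  have h2 : a - eps <= b by rewrite le_max lexx orbT.
  by lra.
move=> a /estimate_sub_qualitative Qa.
by apply: ub_le_sup => //; exists 1.
Qed.

End Exponents.

Theorem corollary5p10 (R : realType) (n : nat) (lam Lam : R)
    (F : set (symmx R n -> R)) :
  (2 <= n)%N -> 0 < lam -> lam <= Lam ->
  F !=set0 -> F `<=` elliptic lam Lam ->
  compact (F : set {family compact, symmx R n -> R}) ->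
  (forall G A t, F G -> G A = 0 -> 0 < t -> F (rescale A t G)) ->
  qualitative_exponents F !=set0 ->
  sup (qualitative_exponents F) = sup (estimate_exponents F).
Proof.
move=> n2 lam0 _ _ Fell cF Frescale.
exact: (sup_exponents (ltnW n2) lam0 Fell cF Frescale).
Qed.
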